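(* Fix $m>-1/2$ and $\phi>0$. For each $c>1$, let $Z_{m,c,\phi}$ follow the McKay Type I distribution with parameters $m$, $c$ and $b=\phi(c^2-1)/c$. Then the function $c\mapsto \operatorname{Med}(Z_{m,c,\phi})$ is strictly increasing on $(1,\infty)$. Consequently, if $G_1\sim\Gamma(m+1/2,(2\phi)^{-1})$ and $G_2\sim\Gamma(2m+1,1/\phi)$, then $$\operatorname{Med}(G_1)<\operatorname{Med}(Z_{m,c,\phi})<\operatorname{Med}(G_2),\qquad c>1.$$ Therefore, for $m>-1/2$ and every $c>1$, $$(2m+1-2\log(2))\phi<(2m+1)\phi e^{-2\log(2)/(2m+1)}<\operatorname{Med}(Z_{m,c,\phi})$$ and $$\operatorname{Med}(Z_{m,c,\phi})<(2m+1)\phi e^{-1/(3(2m+1))}<\left(2m+\frac{2}{3}+\frac{1}{18(2m+1)}\right)\phi,$$ and, for $m\ge 1/2$ and every $c>1$, $$(2m+1/3)\phi<\operatorname{Med}(Z_{m,c,\phi})\le (2m+\log(2))\phi.$$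
   Context: For $b>0$, $c>1$, $m>-1/2$, the McKay Type I distribution with parameters $m,c,b$ is the distribution on $(0,\infty)$ with density $$p(x)=\frac{\sqrt{\pi}(c^2-1)^{m+1/2}}{2^m b^{m+1}\Gamma(m+1/2)}x^m e^{-cx/b}I_m\left(\frac{x}{b}\right),\qquad x>0,$$ where $I_m$ is the modified Bessel function of the first kind. For $r>0$ and $\lambda>0$, $\Gamma(r,\lambda)$ denotes the gamma distribution with shape $r$ and rate $\lambda$, i.e. with density $\frac{\lambda^r}{\Gamma(r)}x^{r-1}e^{-\lambda x}$, $x>0$. The median of a real-valued random variable $X$ is $\operatorname{Med}(X)=\inf\{x\in\mathbb{R}: P(X\le x)\ge 1/2\}$. *)

(* Defs.v *)
From HB Require Import structures.
From mathcomp Require Export all_boot all_order all_algebra.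
From mathcomp Require Export all_classical all_reals all_analysis.
Export Order.TTheory GRing.Theory Num.Theory.
Export numFieldNormedType.Exports.

Set Implicit Arguments.
Unset Strict Implicit.
Unset Printing Implicit Defensive.

Local Open Scope classical_set_scope.
Local Open Scope ring_scope.

(* Euler's integral; meaningful for s > 0 only (junk value otherwise). *)
Definition Gamma {R : realType} (s : R) : R :=
  \int[lebesgue_measure]_(t in `]0, +oo[) (t `^ (s - 1) * expR (- t)).

(* I_nu(x) = \sum_(k >= 0) (x / 2) ^ (2 k + nu) / (k! Gamma(nu + k + 1)).
   Since powR and Gamma are used, this is the modified Bessel function of the
   first kind only for nu > -1 and x > 0. *)
Definition besselI {R : realType} (nu x : R) : R :=
  limn (series (fun k : nat =>
    (x / 2) `^ (2 * k%:R + nu) / (k`!%:R * Gamma (nu + k%:R + 1)))).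

Definition mckay1_pdf {R : realType} (m c b : R) : R -> R :=
  (fun x : R =>
     Num.sqrt pi * (c ^+ 2 - 1) `^ (m + 1 / 2)
       / (2 `^ m * b `^ (m + 1) * Gamma (m + 1 / 2))
     * x `^ m * expR (- (c * x / b)) * besselI m (x / b)) \_ `]0, +oo[.

(* The second parameter is the rate, not the scale. *)
Definition gamma_pdf {R : realType} (r lambda : R) : R -> R :=
  (fun x : R =>
     lambda `^ r / Gamma r * x `^ (r - 1) * expR (- (lambda * x))) \_ `]0, +oo[.

Definition has_density {R : realType} d (T : measurableType d)
    (P : probability T R) (X : {RV P >-> R}) (f : R -> R) : Prop :=
  forall A : set R, measurable A ->
    distribution P X A = (\int[lebesgue_measure]_(x in A) (f x)%:E)%E.

Definition Med {R : realType} d (T : measurableType d)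
    (P : probability T R) (X : {RV P >-> R}) : R :=
  inf [set x : R | ((1 / 2)%:E <= cdf X x)%E].

(* Main.v *)
Require Import Defs.
From mathcomp Require Import measurable_realfun ring lra.

Set Implicit Arguments.
Unset Strict Implicit.
Unset Printing Implicit Defensive.

Local Open Scope classical_set_scope.
Local Open Scope ring_scope.

(** Put [a = 2 m + 1], [r = m + 1/2] and [t = c^2 / (c^2 - 1)], so that [t]
    decreases from infinity to 1 as [c] increases from 1. In the unit [phi],
    the density of the McKay variable is, up to a factor that does not depend
    on [c] ([mckay1_pdfE]), the kernel
      [mckay_kernel m t y = t^r y^(a - 1) exp (- t y) B_m (y^2 (t^2 - t) / 4)],
    where the entire function [B_m (w) = \sum_k w^k / (k! Gamma (m + k + 1))]
    satisfies [I_m (z) = (z / 2)^m B_m (z^2 / 4)].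

    Monotonicity. The kernel obeys a conservation law: its derivative in [t] is
    the derivative in [y] of an explicit flux vanishing at [y = 0]
    ([is_derive_mckay_flux], a consequence of the recurrence of Bessel
    functions). Hence the derivative in [t] of its integral over [0 < y <= x]
    is the flux at [x] ([is_derive_cumul_mckay]), whose sign is that of
    [2 B_m - t x B_(m+1)]. An inequality of Amos type ([besselB_amos]) makes
    this positive as long as [x <= a] ([mckay_flux_gt0]). The total mass being
    the same for all [t], the distribution function at any [x <= a] increases
    strictly with [t], that is, decreases strictly with [c]. Comparing
    distribution functions up to a point beyond the larger median is enough to
    compare medians ([Med_lt_of_cdf_lt]), and [a] is such a point.

    Gamma limits. When [t] tends to 1 the kernel tends to a multiple of the
    gamma kernel of shape [a] and rate 1; when [t] tends to infinity, to a
    multiple of the gamma kernel of shape [r] and rate 1/2, because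
    [z^r exp (- z) B_m (z^2 / 4)] converges at infinity ([besselL_cvg]). Both
    limits are dominated, so that the total mass, the same for all [t], passes
    to the limit and identifies the two multiples. The strict monotonicity in
    [t] puts every McKay distribution function strictly between the two gamma
    ones ([gamma_lt_mckay], [mckay_lt_gamma]).

    Gamma medians. The explicit bounds follow from
      [a exp (- ln 2 / a) <= median <= a exp (- 1 / (3 a))]  and, for [a >= 1],
      [a - 1/3 <= median]
    for the gamma law of shape [a] and rate 1 ([gamma_median_lb],
    [gamma_median_ub], [gamma_median_lb3]). In the variable
    [v = ln (mean / x)] the gamma density is a multiple of
    [exp (- a (exp (- v) + v - 1))]. Its two sides are compared through an
    explicit map [reflection] from the right of the mean to the left, close to
    the one that preserves the exponent; this brackets the excess of the mass
    below the mean over one half. The median is then reached by moving from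
    the mean over a distance that outweighs, or does not exhaust, this excess.
    The last bound of the theorem adds [a exp (- 1 / (3 a)) <= a - 1 + ln 2]
    for [a >= 2] ([mul_expRN_le_ln2]). *)

(** * Derivatives on the real line *)

Section derivatives.
Context {R : realType}.
Implicit Types (f g : R -> R) (a b c s x : R).

(** The rules below speak of functions in applied form, in the direction 1 and
    with the derivative written as a product: they compose as terms, the shape
    of a function dictating the term that differentiates it. *)
Lemma is_derive_cst_pt c x : is_derive x (1 : R) (fun=> c) 0.
Proof. exact: is_derive_cst. Qed.

Lemma is_derive_id_pt x : is_derive x (1 : R) (fun y : R => y) 1.
Proof. exact: is_derive_id. Qed.

Lemma is_derive_add f g x a b : is_derive x (1 : R) f a ->
  is_derive x (1 : R) g b -> is_derive x (1 : R) (fun y => f y + g y) (a + b).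
Proof. by move=> fa gb; exact: is_deriveD. Qed.

Lemma is_derive_opp f x a : is_derive x (1 : R) f a ->
  is_derive x (1 : R) (fun y => - f y) (- a).
Proof. by move=> fa; exact: is_deriveN. Qed.

Lemma is_derive_sub f g x a b : is_derive x (1 : R) f a ->
  is_derive x (1 : R) g b -> is_derive x (1 : R) (fun y => f y - g y) (a - b).
Proof. by move=> fa gb; exact: is_deriveB. Qed.

Lemma is_derive_mul f g x a b : is_derive x (1 : R) f a ->
  is_derive x (1 : R) g b ->
  is_derive x (1 : R) (fun y => f y * g y) (a * g x + f x * b).
Proof.
move=> fa gb; apply: (is_derive_eq (is_deriveM fa gb)).
by rewrite /GRing.scale /= addrC [g x * a]mulrC.
Qed.

Lemma is_derive_scale c f x a : is_derive x (1 : R) f a ->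
  is_derive x (1 : R) (fun y => c * f y) (c * a).
Proof. by move=> fa; exact: is_deriveZ. Qed.

Lemma is_derive_sqr f x a : is_derive x (1 : R) f a ->
  is_derive x (1 : R) (fun y => f y ^+ 2) (2 * f x * a).
Proof.
move=> fa; have := is_derive_mul fa fa.
by under eq_fun do rewrite -expr2; move/is_derive_eq; apply; ring.
Qed.

Lemma is_derive_comp f g x a b : is_derive (g x) (1 : R) f a ->
  is_derive x (1 : R) g b -> is_derive x (1 : R) (fun y => f (g y)) (a * b).
Proof. exact: is_derive1_comp. Qed.

Lemma is_derive_exp f x a : is_derive x (1 : R) f a ->
  is_derive x (1 : R) (fun y => expR (f y)) (expR (f x) * a).
Proof. by move=> fa; apply: is_derive_comp fa; exact: is_derive_expR. Qed.

Lemma is_derive_inv f x a : f x != 0 -> is_derive x (1 : R) f a ->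
  is_derive x (1 : R) (fun y => (f y)^-1) (- a / f x ^+ 2).
Proof.
move=> fx0 fa; apply: (is_derive_eq (@is_deriveV _ f x _ 1 fx0 fa)).
by rewrite /GRing.scale /= mulrC mulrN mulNr.
Qed.

Lemma is_derive_powR s x : 0 < x ->
  is_derive x (1 : R) (fun y => y `^ s) (s * x `^ (s - 1)).
Proof.
move=> x0; have xi : x \in `]0, +oo[ by rewrite in_itv /= x0.
apply: DeriveDef; first exact: derivable_powR.
by rewrite -derive1E powR_derive1.
Qed.

Lemma is_derive_continuous f x a : is_derive x (1 : R) f a ->
  {for x, continuous f}.
Proof. by move=> fa; exact/differentiable_continuous/derivable1_diffP. Qed.

Lemma derive_within_continuous f df a b :
  (forall x, a <= x <= b -> is_derive x (1 : R) f (df x)) ->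
  {within `[a, b], continuous f}.
Proof.
move=> fdf; apply: continuous_in_subspaceT => x; rewrite inE /= in_itv /=.
by move=> /fdf/is_derive_continuous.
Qed.

Lemma derive_ge0_le f df a b : a <= b ->
  (forall x, a <= x <= b -> is_derive x (1 : R) f (df x)) ->
  (forall x, a <= x <= b -> 0 <= df x) -> f a <= f b.
Proof.
move=> ab fdf df0.
have fdf' x : x \in `]a, b[ -> is_derive x (1 : R) f (df x).
  by rewrite in_itv /= => /andP[ax xb]; apply: fdf; rewrite !ltW.
have [c + fE] := MVT_segment ab fdf' (derive_within_continuous fdf).
rewrite in_itv /= => /df0 dfc.
by rewrite -subr_ge0 fE mulr_ge0// subr_ge0.
Qed.

Lemma derive_gt0_lt f df a b : a < b ->
  (forall x, a <= x <= b -> is_derive x (1 : R) f (df x)) ->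
  (forall x, a < x < b -> 0 < df x) -> f a < f b.
Proof.
move=> ab fdf df0.
have fdf' x : x \in `]a, b[ -> is_derive x (1 : R) f (df x).
  by rewrite in_itv /= => /andP[ax xb]; apply: fdf; rewrite !ltW.
have [c + fE] := MVT ab fdf' (derive_within_continuous fdf).
rewrite in_itv /= => /df0 dfc.
by rewrite -subr_gt0 fE mulr_gt0// subr_gt0.
Qed.

End derivatives.

(** * Integrals over the positive half-line *)

Section cumulative_integrals.
Context {R : realType}.
Implicit Types (f g : R -> R) (a b c s x : R).
Notation mu := (@lebesgue_measure R).

Definition halfline_integrable f : Prop :=
  (forall x, 0 < x -> {for x, continuous f}) /\
  mu.-integrable `]0, +oo[ (EFin \o f).

Definition cumul f x : R := \int[mu]_(t in `]0, x]) f t.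

Definition total f : R := \int[mu]_(t in `]0, +oo[) f t.

Lemma halfline_measurable f : (forall x, 0 < x -> {for x, continuous f}) ->
  measurable_fun (`]0, +oo[ : set R) f.
Proof.
move=> cf; apply: open_continuous_measurable_fun; first exact: interval_open.
by move=> x; rewrite inE /= in_itv /= andbT => /cf.
Qed.

(** The integrable majorant makes the integral of the limit finite, so that
    dominated convergence can be read in [R] itself. *)
Lemma dominated_Rintegral (D : set R) (fn : nat -> R -> R) f g :
  measurable D -> (forall n, measurable_fun D (fn n)) -> measurable_fun D f ->
  mu.-integrable D (EFin \o g) ->
  (forall n x, D x -> `|fn n x| <= g x) ->
  (forall x, D x -> fn n x @[n --> \oo] --> f x) ->
  \int[mu]_(x in D) fn n x @[n --> \oo] --> \int[mu]_(x in D) f x.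
Proof.
move=> mD mfn mf ig fng fnf.
have [||||intf _ +] := @dominated_convergence _ _ R mu D mD
    (fun n => EFin \o fn n) (EFin \o f) (EFin \o g) _ _ _ ig.
- by move=> n; apply/measurable_EFinP; exact: mfn.
- exact/measurable_EFinP.
- by apply: aeW => x Dx; apply: cvg_EFin; [exact: nearW|exact: fnf].
- by apply: aeW => x n Dx /=; rewrite lee_fin fng.
have intE : (\int[mu]_(x in D) (EFin \o f) x)%E \is a fin_num.
  exact: integrable_fin_num.
by rewrite -(fineK intE) => /fine_cvg.
Qed.

Lemma halfline_sub (x : R) : `]0, x] `<=` (`]0, +oo[ : set R).
Proof. by move=> t /=; rewrite !in_itv /= => /andP[->]. Qed.

Lemma cumul_integrable f x : halfline_integrable f ->
  mu.-integrable `]0, x] (EFin \o f).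
Proof. by move=> [_]; apply: integrableS => //; exact: halfline_sub. Qed.

Lemma cumul_mkcond f x :
  cumul f x = \int[mu]_(t in `]0, +oo[) (f \_ `]0, x]) t.
Proof.
rewrite -Rintegral_mkcondr /cumul; congr Rintegral.
by rewrite setIC; apply/esym/setIidl; exact: halfline_sub.
Qed.

Lemma is_derive_cumul f x : halfline_integrable f -> 0 < x ->
  is_derive x (1 : R) (cumul f) (f x).
Proof.
move=> hf x0.
have [||||df dfE] := @continuous_FTC1 R f (BRight 0) x (x + 1).
- by rewrite ltrDl.
- exact: cumul_integrable.
- exact: x0.
- exact: hf.1.
by apply: DeriveDef; [exact: df|rewrite -derive1E; exact: dfE].
Qed.

Lemma patch_le f (A : set R) x : `|(f \_ A) x| <= `|f x|.
Proof. by rewrite patchE; case: ifP => // _; rewrite normr0. Qed.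

(** [cumul f x] is the integral over the whole half-line of the restriction of
    [f] to [0 < t <= x], which [|f|] dominates: the behaviours at 0 and at
    infinity only differ by the pointwise limit of these restrictions. *)
Lemma cumul_cvg f (A : set R) (u : nat -> R) : halfline_integrable f ->
  measurable A ->
  (forall t, 0 < t -> \forall n \near \oo, (f \_ `]0, u n]) t = (f \_ A) t) ->
  cumul f (u n) @[n --> \oo] --> \int[mu]_(t in `]0, +oo[) (f \_ A) t.
Proof.
move=> [cf intf] mA fuA.
under eq_cvg do rewrite cumul_mkcond.
have mf := halfline_measurable cf.
apply: (@dominated_Rintegral _ _ _ (fun x => `|f x|)) => //.
- by move=> n; apply/measurable_restrict => //; exact: measurable_funS mf.
- by apply/measurable_restrict => //; exact: measurable_funS mf.
- exact: (integrable_norm intf).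
- by move=> n x _; exact: patch_le.
move=> t /=; rewrite in_itv /= andbT => t0.
by apply: cvg_near_cst; exact: fuA.
Qed.

Lemma cumul_cvg0 f : halfline_integrable f -> cumul f x @[x --> 0^'+] --> 0.
Proof.
move=> hf; apply/cvg_at_rightP => u [u0 ucvg].
rewrite -[X in _ --> X](_ : \int[mu]_(t in `]0, +oo[) (f \_ set0) t = 0);
  last first.
  rewrite (@eq_Rintegral _ _ _ _ _ (fun=> 0)); first by rewrite /Rintegral integral0.
  by move=> t _; rewrite patch_set0.
apply: cumul_cvg => // t t0; near=> n; rewrite patch_set0 patchE memNset//=.
rewrite in_itv /= t0 /=; apply/negP; rewrite -ltNge.
near: n; move/cvgrPdist_lt : ucvg => /(_ _ t0); apply: filterS => n.
by rewrite sub0r normrN gtr0_norm.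
Unshelve. all: by end_near. Qed.

Lemma cumul_cvgy f : halfline_integrable f -> cumul f x @[x --> +oo] --> total f.
Proof.
move=> hf; apply/cvg_pinftyP => u ucvg.
rewrite -[X in _ --> X](_ : \int[mu]_(t in `]0, +oo[) (f \_ setT) t = _);
  last by rewrite patch_setT.
apply: cumul_cvg => // t t0; near=> n; rewrite patch_setT patchE mem_set//=.
rewrite in_itv /= t0 /=.
by near: n; move/cvgryPge : ucvg; exact.
Unshelve. all: by end_near. Qed.

End cumulative_integrals.

Section primitives.
Context {R : realType}.
Implicit Types (f g df F H : R -> R) (a b c s x y l C : R).
Notation mu := (@lebesgue_measure R).

(** Monotonicity for functions that only have a limit at the left end, as
    powers and cumulative integrals do at 0. *)
Lemma derive_ge0_cvg_le f df l x : 0 < x ->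
  (forall y, 0 < y -> is_derive y (1 : R) f (df y)) ->
  (forall y, 0 < y -> 0 <= df y) -> f y @[y --> 0^'+] --> l -> l <= f x.
Proof.
move=> x0 fdf df0 fl; apply: (cvgr_to_le fl); near=> y.
have y0 : 0 < y by near: y; exact: nbhs_right_gt.
have yx : y <= x by near: y; exact: nbhs_right_le.
by apply: (derive_ge0_le yx) => z /andP[yz _];
  [apply: fdf|apply: df0]; exact: lt_le_trans yz.
Unshelve. all: by end_near. Qed.

(** A primitive that vanishes at 0 determines the cumulative integral. Changes
    of variable and integrations by parts below are instances: the candidate
    is differentiated instead. *)
Lemma cumul_unique f F x : halfline_integrable f -> 0 < x ->
  (forall y, 0 < y -> is_derive y (1 : R) F (f y)) ->
  F y @[y --> 0^'+] --> 0 -> cumul f x = F x.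
Proof.
move=> hf x0 dF F0; have C0 := cumul_cvg0 hf.
apply/eqP; rewrite eq_le; apply/andP; split; rewrite -subr_ge0.
- apply: (@derive_ge0_cvg_le (fun y => F y - cumul f y) (fun=> 0)) => //.
    move=> y y0; rewrite -(subrr (f y)); apply: is_derive_sub.
      exact: dF.
    exact: is_derive_cumul.
  by rewrite -[X in _ --> X](subrr 0); exact: cvgB.
- apply: (@derive_ge0_cvg_le (fun y => cumul f y - F y) (fun=> 0)) => //.
    move=> y y0; rewrite -(subrr (f y)); apply: is_derive_sub.
      exact: is_derive_cumul.
    exact: dF.
  by rewrite -[X in _ --> X](subrr 0); exact: cvgB.
Qed.

Lemma cumul_scale f c x : halfline_integrable f ->
  halfline_integrable (fun y => f (y / c)) -> 0 < c -> 0 < x ->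
  cumul (fun y => f (y / c)) x = c * cumul f (x / c).
Proof.
move=> hf hfc c0 x0.
apply: (@cumul_unique _ (fun y => c * cumul f (y / c))) => //.
- move=> y y0; have c'0 : c != 0 by rewrite gt_eqF.
  have yc : is_derive y (1 : R) (fun y => y / c) c^-1.
    apply: (is_derive_eq (is_derive_mul (is_derive_id_pt y) (is_derive_cst_pt _ _))).
    by rewrite mulr0 addr0 mul1r.
  apply: (is_derive_eq (is_derive_scale c (is_derive_comp (is_derive_cumul hf _) yc))).
    by rewrite divr_gt0.
  by field.
- rewrite -[X in _ --> X](mulr0 c); apply: cvgM; first exact: cvg_cst.
  apply/cvg_at_rightP => u [u0 ucvg].
  have /cvg_at_rightP/(_ (fun n => u n / c)) := cumul_cvg0 hf; apply; split.
    by move=> n; exact: divr_gt0.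
  by rewrite -[X in _ --> X](mul0r c^-1); apply: cvgM => //; exact: cvg_cst.
Qed.

Lemma cvg_natS_y : n.+1%:R @[n --> \oo] --> (+oo : set_system R).
Proof. by rewrite (cvg_shiftS (fun n => n%:R : R)); exact: cvgr_idn. Qed.

Lemma total_scale f c : halfline_integrable f ->
  halfline_integrable (fun y => f (y / c)) -> 0 < c ->
  total (fun y => f (y / c)) = c * total f.
Proof.
move=> hf hfc c0.
have cy : c * n.+1%:R @[n --> \oo] --> (+oo : set_system R).
  exact: cvg_comp cvg_natS_y (gt0_cvgMry c0 cvg_id).
have /cvg_pinftyP/(_ _ cy) := cumul_cvgy hfc.
have -> : (fun n => cumul (fun y => f (y / c)) (c * n.+1%:R)) =
          (fun n => c * cumul f n.+1%:R).
  apply/funext => n; rewrite cumul_scale ?mulr_gt0//.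
  by rewrite mulrAC divff ?mul1r// gt_eqF.
move=> h; apply: (cvg_unique _ h) => //.
apply: cvgM; first exact: cvg_cst.
by have /cvg_pinftyP := cumul_cvgy hf; apply; exact: cvg_natS_y.
Qed.

(** Integrability without a majorant: over [1/(n+1) <= x <= n+2] the integral
    of a nonnegative function is a difference of two values of its primitive,
    at most [2 C], and these intervals exhaust the half-line. *)
Lemma bounded_primitive_integrable f H C :
  (forall x, 0 < x -> {for x, continuous f}) ->
  (forall x, 0 < x -> 0 <= f x) ->
  (forall x, 0 < x -> is_derive x (1 : R) H (f x)) ->
  (forall x, 0 < x -> `|H x| <= C) ->
  halfline_integrable f.
Proof.
move=> cf f0 dH HC; split => //; apply/integrableP; split.
  by apply/measurable_EFinP; exact: halfline_measurable.
pose F (n : nat) : set R := [set` `[n.+1%:R^-1, n.+2%:R]].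
have FE : \bigcup_n F n = [set` `]0, +oo[ : interval R].
  rewrite eqEsubset; split => [x [n _]|x]; rewrite /F /= !in_itv /= ?andbT.
    by move=> /andP[+ _]; apply: lt_le_trans.
  move=> x0; pose N := (Num.truncn x + Num.truncn x^-1)%N.
  exists N => //=; rewrite in_itv /=; apply/andP; split.
    rewrite -[leRHS]invrK lef_pV2 ?posrE ?invr_gt0//.
    apply: (le_trans (ltW (truncnS_gt _))); rewrite ler_nat ltnS.
    exact: leq_addl.
  apply: (le_trans (ltW (truncnS_gt _))); rewrite ler_nat ltnS.
  by rewrite (leq_trans (leq_addr _ _) (leqnSn _)).
rewrite -FE.
have Fn0 n x : F n x -> 0 < x.
  by rewrite /F /= in_itv /= => /andP[+ _]; apply: lt_le_trans.
have Flt n : n.+1%:R^-1 < n.+2%:R :> R.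
  by rewrite (@le_lt_trans _ _ 1)// ?invf_le1 ?ler1n// ltr1n.
have Fl0 n : 0 < n.+1%:R^-1 :> R by rewrite invr_gt0.
have intF n : (\int[mu]_(x in F n) `|(f x)%:E| <= (C + C)%:E)%E.
  have -> : (\int[mu]_(x in F n) `|(f x)%:E| = \int[mu]_(x in F n) (f x)%:E)%E.
    apply: eq_integral => x; rewrite inE => /Fn0 x0.
    by rewrite abse_EFin ger0_norm ?f0.
  rewrite (@continuous_FTC2 _ f H _ _ (Flt n)).
  - rewrite -EFinB lee_fin (le_trans (ler_norm _))// (le_trans (ler_normB _ _))//.
    by rewrite lerD// HC.
  - apply: continuous_in_subspaceT => x; rewrite inE => /Fn0; exact: cf.
  - split.
    + by move=> x; rewrite in_itv /= => /andP[/(lt_trans (Fl0 n)) x0 _];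
        case: (dH _ x0).
    + by apply: cvg_at_right_filter; exact: (is_derive_continuous (dH _ (Fl0 n))).
    + by apply: cvg_at_left_filter; apply: (is_derive_continuous (dH _ _)).
  - move=> x; rewrite in_itv /= => /andP[/(lt_trans (Fl0 n)) x0 _].
    by rewrite derive1E; case: (dH _ x0).
apply: (@le_lt_trans _ _ (C + C)%:E); last exact: ltry.
have mf := halfline_measurable cf.
have cv : (\int[mu]_(x in F n) `|(f x)%:E|)%E @[n --> \oo] -->
    (\int[mu]_(x in \bigcup_n F n) `|(f x)%:E|)%E.
  apply: ge0_nondecreasing_set_cvg_integral.
  - apply/nondecreasing_seqP => n; apply/subsetPset => x; rewrite /F /= !in_itv /=.
    move=> /andP[nx xn]; apply/andP; split.
      by rewrite (le_trans _ nx)// lef_pV2 ?posrE// ler_nat.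
    by rewrite (le_trans xn)// ler_nat.
  - by move=> n; exact: measurable_itv.
  - move=> n; apply/measurable_EFinP; apply: measurableT_comp => //.
    by apply: measurable_funS mf => // x /Fn0; rewrite /= in_itv /= andbT.
  - by move=> n x _; exact: abse_ge0.
by apply: (cvge_to_le cv); exact: nearW.
Qed.

Lemma halfline_dominated f g C : halfline_integrable g ->
  (forall x, 0 < x -> {for x, continuous f}) ->
  (forall x, 0 < x -> `|f x| <= C * g x) -> halfline_integrable f.
Proof.
move=> [_ ig] cf fg; split=> //.
have iCg : mu.-integrable `]0, +oo[ (fun x => (C * g x)%:E).
  exact: (@integrableZl _ _ _ mu _ _ C (EFin \o g)).
apply: le_integrable iCg => //.
- by apply/measurable_EFinP; exact: halfline_measurable.
- move=> x; rewrite /= in_itv /= andbT => /fg fgx.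
  by rewrite lee_fin (le_trans fgx)// ler_norm.
Qed.

Lemma cumul_gt0 f x : halfline_integrable f -> (forall y, 0 < y -> 0 < f y) ->
  0 < x -> 0 < cumul f x.
Proof.
move=> hf f0 x0; have x20 : 0 < x / 2 by rewrite divr_gt0.
apply: (@le_lt_trans _ _ (cumul f (x / 2))).
  apply: (derive_ge0_cvg_le x20 _ _ (cumul_cvg0 hf)) => y y0.
    exact: is_derive_cumul.
  exact/ltW/f0.
apply: (@derive_gt0_lt _ _ f); first by rewrite ltr_pdivrMr// mulr_natr mulr2n ltrDl.
  by move=> y /andP[/(lt_le_trans x20) y0 _]; exact: is_derive_cumul.
by move=> y /andP[/(lt_trans x20) y0 _]; exact: f0.
Qed.

Lemma cumul_le_total f x : halfline_integrable f ->
  (forall y, 0 < y -> 0 <= f y) -> 0 < x -> cumul f x <= total f.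
Proof.
move=> hf f0 x0; apply: (cvgr_to_ge (cumul_cvgy hf)); near=> y.
have xy : x <= y by near: y; apply: nbhs_pinfty_ge; exact: num_real.
apply: (@derive_ge0_le _ _ f) => // z /andP[/(lt_le_trans x0) z0 _].
  exact: is_derive_cumul.
exact: f0.
Unshelve. all: by end_near. Qed.

Lemma total_gt0 f : halfline_integrable f -> (forall y, 0 < y -> 0 < f y) ->
  0 < total f.
Proof.
move=> hf f0; apply: (@lt_le_trans _ _ (cumul f 1)); first exact: cumul_gt0.
by apply: cumul_le_total => // y /f0/ltW.
Qed.

End primitives.

(** * The gamma kernel and Euler's integral *)

Section gamma_kernel.
Context {R : realType}.
Implicit Types (f g df F H : R -> R) (a b c s x y l C : R).

(** This is [ln z <= z] at [z = (c / s) x]. *)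
Lemma powR_le_expR s c : 0 < s -> 0 < c ->
  exists2 K, 1 <= K & forall x, 0 < x -> x `^ s <= K * expR (c * x).
Proof.
move=> s0 c0; pose e := c / s.
have e0 : 0 < e by rewrite divr_gt0.
(* the summand 1 only ensures K >= 1 *)
exists (1 + expR (- (s * ln e))); first by rewrite lerDl expR_ge0.
move=> x x0; apply: (@le_trans _ _ (expR (- (s * ln e)) * expR (c * x))).
  rewrite /powR gt_eqF// -expRD ler_expR.
  have := ltW (ln_sublinear (mulr_gt0 e0 x0)).
  rewrite lnM ?posrE// => h.
  have -> : c * x = s * (e * x) by rewrite /e; field; rewrite gt_eqF.
  by rewrite addrC -mulrBr ler_pM2l// lerBrDl.
by rewrite ler_pM2r ?expR_gt0// lerDr.
Qed.

Definition gamma_kernel s l x : R := x `^ (s - 1) * expR (- (l * x)).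

Lemma gamma_kernel_gt0 s l x : 0 < x -> 0 < gamma_kernel s l x.
Proof. by move=> x0; rewrite mulr_gt0 ?expR_gt0// powR_gt0. Qed.

Lemma is_derive_expRNM l x :
  is_derive x (1 : R) (fun y => expR (- (l * y))) (- l * expR (- (l * x))).
Proof.
have h := is_derive_opp (is_derive_scale l (is_derive_id_pt x)).
by apply: (is_derive_eq (is_derive_exp h)); ring.
Qed.

Lemma gamma_kernel_continuous s l x : 0 < x ->
  {for x, continuous (gamma_kernel s l)}.
Proof.
move=> x0; apply: (is_derive_continuous (f := gamma_kernel s l)).
exact: (is_derive_mul (is_derive_powR (s - 1) x0) (is_derive_expRNM l x)).
Qed.

(** The bounded function [- 1 / (1 + x^s)] has the derivative
    [s x^(s-1) / (1 + x^s)^2], which is therefore integrable, and the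
    exponential decay beats [(1 + x^s)^2]. The singularity at 0 and the tail at
    infinity are so treated together. *)
Lemma gamma_kernel_integrable s l : 0 < s -> 0 < l ->
  halfline_integrable (gamma_kernel s l).
Proof.
move=> s0 l0.
pose f x := s * x `^ (s - 1) / (1 + x `^ s) ^+ 2.
have p0 x : 0 < 1 + x `^ s by rewrite ltr_wpDr// powR_ge0.
have df x : 0 < x -> is_derive x (1 : R) (fun y => - (1 + y `^ s)^-1) (f x).
  move=> x0; have h := is_derive_add (is_derive_cst_pt 1 x) (is_derive_powR s x0).
  apply: (is_derive_eq (is_derive_opp (is_derive_inv _ h))); first by rewrite gt_eqF.
  by rewrite /f add0r mulNr opprK.
have hf : halfline_integrable f.
  apply: (@bounded_primitive_integrable _ f _ 1 _ _ df).
  - move=> x x0; have h1 := is_derive_scale s (is_derive_powR (s - 1) x0).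
    have h2 := is_derive_sqr (is_derive_add (is_derive_cst_pt 1 x) (is_derive_powR s x0)).
    apply: (is_derive_continuous (is_derive_mul h1 (is_derive_inv _ h2))).
    by rewrite sqrf_eq0 gt_eqF.
  - by move=> x x0; rewrite /f divr_ge0 ?sqr_ge0// mulr_ge0 ?powR_ge0// ltW.
  - move=> x x0; rewrite normrN gtr0_norm ?invr_gt0//.
    by rewrite invf_le1// lerDl powR_ge0.
have l20 : 0 < l / 2 by rewrite divr_gt0.
have [K K1 xK] := powR_le_expR s0 l20.
have K0 : 0 < K := lt_le_trans ltr01 K1.
apply: (halfline_dominated (C := (1 + K) ^+ 2 / s) hf).
  by move=> x; exact: gamma_kernel_continuous.
move=> x x0; rewrite ger0_norm ?(ltW (gamma_kernel_gt0 _ _ _))// /gamma_kernel /f.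
have -> : (1 + K) ^+ 2 / s * (s * x `^ (s - 1) / (1 + x `^ s) ^+ 2) =
   x `^ (s - 1) * ((1 + K) ^+ 2 / (1 + x `^ s) ^+ 2).
  by field; rewrite !gt_eqF.
rewrite ler_pM2l ?powR_gt0// expRN ler_pdivlMr ?exprn_gt0//.
rewrite mulrC ler_pdivrMr ?expR_gt0//.
have -> : l * x = (l / 2 * x) * 2%:R by field.
rewrite expRM_natr -exprMn lerXn2r ?nnegrE ?mulr_ge0 ?expR_ge0 ?(ltW (p0 _))//.
  by rewrite addr_ge0// ltW.
rewrite mulrDl mul1r lerD ?xK//.
apply: (le_trans _ (expR_ge1Dx _)); rewrite lerDl.
by apply: mulr_ge0; exact: ltW.
Qed.

Lemma GammaE s : Gamma s = total (gamma_kernel s 1).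
Proof. by apply: eq_Rintegral => x _; rewrite /gamma_kernel mul1r. Qed.

Lemma Gamma_gt0 s : 0 < s -> 0 < Gamma s.
Proof.
move=> s0; rewrite GammaE total_gt0//; first exact: gamma_kernel_integrable.
by move=> y; exact: gamma_kernel_gt0.
Qed.

(** Integration by parts; the boundary term [x^s exp (- x)] vanishes at both
    ends of the half-line. *)
Lemma GammaS s : 0 < s -> Gamma (s + 1) = s * Gamma s.
Proof.
move=> s0; have s10 : 0 < s + 1 by rewrite addr_gt0.
have h0 := gamma_kernel_integrable s0 ltr01.
have h1 := gamma_kernel_integrable s10 ltr01.
pose G x := x `^ s * expR (- (1 * x)).
have cE x : 0 < x ->
    cumul (gamma_kernel (s + 1) 1) x = s * cumul (gamma_kernel s 1) x - G x.
  move=> x0; apply: (@cumul_unique _ _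
      (fun y => s * cumul (gamma_kernel s 1) y - G y)) => //.
    move=> y y0; have d1 := is_derive_scale s (is_derive_cumul h0 y0).
    have d2 := is_derive_mul (is_derive_powR s y0) (is_derive_expRNM 1 y).
    apply: (is_derive_eq (is_derive_sub d1 d2)).
    by rewrite /gamma_kernel addrK; ring.
  rewrite -[X in _ --> X](subrr 0); apply: cvgB.
    rewrite -[X in _ --> X](mulr0 s); apply: cvgM; first exact: cvg_cst.
    exact: cumul_cvg0.
  rewrite -[X in _ --> X](mul0r (expR (- (1 * 0)))); apply: cvgM.
    exact: powR_cvg0.
  apply: cvg_at_right_filter.
  exact: (is_derive_continuous (is_derive_expRNM 1 0)).
have Gy : G x @[x --> +oo] --> 0.
  have h : 0 < (1 / 2 : R) by rewrite divr_gt0.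
  have [K K1 xK] := powR_le_expR s0 h.
  have K0 : 0 <= K := le_trans ler01 K1.
  apply: (squeeze_cvgr (f := cst 0) (h := fun x => K * expR (- (x * (1 / 2))))).
  - near=> x; have x0 : 0 < x by near: x; apply: nbhs_pinfty_gt; exact: num_real.
    rewrite /G mulr_ge0 ?powR_ge0 ?expR_ge0//=.
    rewrite (le_trans (ler_wpM2r (expR_ge0 _) (xK _ x0)))//.
    rewrite -mulrA -expRD ler_wpM2l// ler_expR; lra.
  - exact: cvg_cst.
  - rewrite -[X in _ --> X](mulr0 K); apply: cvgM; first exact: cvg_cst.
    apply: (cvg_comp (fun x : R => x * (1 / 2)) (fun x => expR (- x)));
      last exact: cvgr_expR.
    exact: gt0_cvgMly h cvg_id.
rewrite !GammaE; apply: (cvg_unique _ (cumul_cvgy h1)) => //.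
have H : s * cumul (gamma_kernel s 1) x - G x @[x --> +oo] -->
    s * total (gamma_kernel s 1).
  rewrite -[X in _ --> X]subr0; apply: cvgB => //.
  by apply: cvgM; [exact: cvg_cst|exact: cumul_cvgy].
apply: cvg_trans H; apply: near_eq_cvg; near=> x.
by rewrite cE.
Unshelve. all: by end_near. Qed.

End gamma_kernel.

(** * Exponential inequalities *)

Section exp_inequalities.
Context {R : realType}.
Implicit Types (a b c d e f g h k q v x y : R).

Lemma derive_ge0_ge0 (f df : R -> R) q : 0 <= q -> f 0 = 0 ->
  (forall x, is_derive x (1 : R) f (df x)) ->
  (forall x, 0 <= x -> 0 <= df x) -> 0 <= f q.
Proof.
by move=> q0 f0 fdf df0; rewrite -f0;
  apply: (@derive_ge0_le _ f df) => // x /andP[/df0].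
Qed.

(** Differentiation only changes the coefficients within this family, so that
    nonnegativity on [q >= 0] reduces to values at 0 and to the sign of a
    derivative of high enough order. *)
Definition exp_quadratic a b c d e f g h q : R :=
  expR q ^+ 2 * (a * q + b) - expR q * (c * q ^+ 2 + d * q + e)
  + (f * q ^+ 2 + g * q + h).

Lemma is_derive_affine a b q : is_derive q (1 : R) (fun x => a * x + b) a.
Proof.
have := is_derive_add (is_derive_scale a (is_derive_id_pt q)) (is_derive_cst_pt b q).
by move/is_derive_eq; apply; rewrite mulr1 addr0.
Qed.

Lemma is_derive_quadratic a b c q :
  is_derive q (1 : R) (fun x => a * x ^+ 2 + b * x + c) (2 * a * q + b).
Proof.
have h1 := is_derive_scale a (is_derive_sqr (is_derive_id_pt q)).
have h2 := is_derive_scale b (is_derive_id_pt q).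
apply: (is_derive_eq (is_derive_add (is_derive_add h1 h2) (is_derive_cst_pt c q))).
ring.
Qed.

Lemma is_derive_exp_quadratic a b c d e f g h q :
  is_derive q (1 : R) (exp_quadratic a b c d e f g h)
    (exp_quadratic (2 * a) (2 * b + a) c (d + 2 * c) (e + d) 0 (2 * f) g q).
Proof.
have E := is_derive_exp (is_derive_id_pt q).
have h1 := is_derive_mul (is_derive_sqr E) (is_derive_affine a b q).
have h2 := is_derive_mul E (is_derive_quadratic c d e q).
apply: (is_derive_eq (is_derive_add (is_derive_sub h1 h2) (is_derive_quadratic f g h q))).
by rewrite /exp_quadratic; ring.
Qed.

(** The derivative is [2 exp x (exp x - 2 x - exp (- x))], that is,
    [4 exp x (sinh x - x)]. *)
Lemma exp_quadratic_ineq1 q : 0 <= q ->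
  0 <= expR q ^+ 2 + 4 * expR q - 5 - 4 * q * expR q - 2 * q.
Proof.
move=> q0; rewrite [leRHS](_ : _ = exp_quadratic 0 1 0 4 (-4) 0 (-2) (-5) q);
  last by rewrite /exp_quadratic; ring.
apply: derive_ge0_ge0 q0 _ (is_derive_exp_quadratic _ _ _ _ _ _ _ _) _.
  by rewrite /exp_quadratic expR0; ring.
move=> x x0; rewrite /exp_quadratic.
suff h : 0 <= expR x - 2 * x - expR (- x).
  have -> : expR x ^+ 2 * (2 * 0 * x + (2 * 1 + 0)) -
    expR x * (0 * x ^+ 2 + (4 + 2 * 0) * x + (-4 + 4)) +
    (0 * x ^+ 2 + 2 * 0 * x + -2) = 2 * expR x * (expR x - 2 * x - expR (- x))
      + 2 * (expR x * expR (- x) - 1) by ring.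
  rewrite expRxMexpNx_1 subrr mulr0 addr0.
  by rewrite mulr_ge0// mulr_ge0// expR_ge0.
apply: (derive_ge0_ge0 (f := fun x => expR x - 2 * x - expR (- x))
  (df := fun x => expR x - 2 + expR (- x)) x0).
- by rewrite oppr0 expR0; ring.
- move=> y; have E := is_derive_exp (is_derive_id_pt y).
  have E' := is_derive_exp (is_derive_opp (is_derive_id_pt y)).
  have L := is_derive_scale 2 (is_derive_id_pt y).
  by apply: (is_derive_eq (is_derive_sub (is_derive_sub E L) E')); ring.
- move=> y y0; have E0 := expR_gt0 y; have := expRxMexpNx_1 y.
  set E := expR y in E0 *; set E' := expR (- y) => EE.
  have E'0 : 0 < E' by exact: expR_gt0.
  have -> : E - 2 + E' = E' * (E - 1) ^+ 2 - (E - 2) * (E * E' - 1) by ring.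
  by rewrite EE subrr mulr0 subr0 mulr_ge0 ?sqr_ge0// ltW.
Qed.

(** The function and its first three derivatives vanish at 0; the fourth
    derivative is [exp x] times an expression that [exp x >= 1 + x] bounds
    below. *)
Lemma exp_quadratic_ineq2 q : 0 <= q ->
  0 <= expR q ^+ 2 * (4 * q - 7) - expR q * (4 * q ^+ 2 - 24 * q + 40)
       + (6 * q ^+ 2 + 26 * q + 47).
Proof.
move=> q0; rewrite [leRHS](_ : _ = exp_quadratic 4 (-7) 4 (-24) 40 6 26 47 q);
  last by rewrite /exp_quadratic; ring.
have step a b c d e f g h : exp_quadratic a b c d e f g h 0 = 0 ->
  (forall x, 0 <= x -> 0 <=
     exp_quadratic (2 * a) (2 * b + a) c (d + 2 * c) (e + d) 0 (2 * f) g x) ->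
  forall x, 0 <= x -> 0 <= exp_quadratic a b c d e f g h x.
  move=> h0 hd x x0; apply: derive_ge0_ge0 x0 h0 _ hd.
  exact: is_derive_exp_quadratic.
have at0 a b c d e f g h : b - e + h = 0 -> exp_quadratic a b c d e f g h 0 = 0.
  move=> bf; rewrite [LHS](_ : _ = b - e + h)// /exp_quadratic expR0; ring.
move: q q0; apply: (step _ _ _ _ _ _ _ _); first by apply: at0; ring.
apply: (step _ _ _ _ _ _ _ _); first by apply: at0; ring.
apply: (step _ _ _ _ _ _ _ _); first by apply: at0; ring.
apply: (step _ _ _ _ _ _ _ _); first by apply: at0; ring.
move=> x x0; rewrite /exp_quadratic.
have E1 := expR_ge1Dx x; set E := expR x in E1 *.
rewrite [leRHS](_ : _ = E * (E * (64 * x + 16) - (4 * x ^+ 2 + 8 * x - 8)));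
  last by ring.
apply: mulr_ge0; first exact: expR_ge0.
nra.
Qed.

(** In the variable [v = ln (mean / x)], the gamma density of shape [a] is a
    multiple of [exp (- a * hgap v)]; beyond the mean, at [v = - q], the
    exponent is written [kgap q]. *)
Definition hgap v : R := expR (- v) + v - 1.
Definition kgap q : R := expR q - q - 1.

Lemma hgapN q : hgap (- q) = kgap q.
Proof. by rewrite /hgap opprK. Qed.

Lemma is_derive_kgap q : is_derive q (1 : R) kgap (expR q - 1).
Proof.
have E := is_derive_exp (is_derive_id_pt q).
apply: (is_derive_eq (is_derive_sub (is_derive_sub E (is_derive_id_pt q))
  (is_derive_cst_pt 1 q))).
ring.
Qed.

Lemma kgap_ge0 q : 0 <= kgap q.
Proof. by rewrite /kgap subr_ge0 lerBrDr expR_ge1Dx. Qed.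

Lemma kgap0 : kgap 0 = 0.
Proof. by rewrite /kgap expR0; ring. Qed.

Lemma hgap_ge0 v : 0 <= hgap v.
Proof. by rewrite -(opprK v) hgapN kgap_ge0. Qed.

(** An approximation of the map that sends [q] to the [v >= 0] with
    [hgap v = kgap q], the point below the mean with the same density. As a
    polynomial in [kgap q] added to [q], it makes the comparison integrals
    elementary. The exact map has [c = 2 / 3] as its first coefficient. *)
Definition reflection c k q := q + c * kgap q + k * kgap q ^+ 2.

Definition reflection' c k q :=
  1 + (c + 2 * k * kgap q) * (expR q - 1).

Lemma is_derive_reflection c k q :
  is_derive q (1 : R) (reflection c k) (reflection' c k q).
Proof.
have K := is_derive_kgap q.
apply: (is_derive_eq (is_derive_add (is_derive_add (is_derive_id_pt q)
  (is_derive_scale c K)) (is_derive_scale k (is_derive_sqr K)))).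
by rewrite /reflection'; ring.
Qed.

Lemma reflection0 c k : reflection c k 0 = 0.
Proof. by rewrite /reflection kgap0; ring. Qed.

(* Multiplying [kgap q - hgap (reflection q)] by [exp (reflection q)] clears
   the inner exponential of [hgap]; the derivative is then a positive factor
   times an expression in which [exp q] is the only exponential. *)
Let F c k q := expR (reflection c k q) * (1 + kgap q - reflection c k q).
Let F' c k q := expR (reflection c k q) *
   (reflection' c k q * (kgap q - reflection c k q) + expR q - 1).

Let is_derive_F c k q : is_derive q (1 : R) (F c k) (F' c k q).
Proof.
have K := is_derive_add (is_derive_cst_pt 1 q) (is_derive_kgap q).
have G := is_derive_reflection c k q.
apply: (is_derive_eq (is_derive_mul (is_derive_exp G) (is_derive_sub K G))).
by rewrite /F'; ring.
Qed.

Let F0 c k : F c k 0 = 1.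
Proof. by rewrite /F reflection0 kgap0 expR0; ring. Qed.

Let FE c k q : F c k q - 1 =
  expR (reflection c k q) * (kgap q - hgap (reflection c k q)).
Proof.
have := expRxMexpNx_1 (reflection c k q).
by rewrite /F /hgap => EE; rewrite -[X in _ - X = _]EE; ring.
Qed.

Lemma hgap_reflection_le c k q : 0 <= q ->
  (forall x, 0 <= x ->
    0 <= reflection' c k x * (kgap x - reflection c k x) + expR x - 1) ->
  hgap (reflection c k q) <= kgap q.
Proof.
move=> q0 h; rewrite -subr_ge0 -(pmulr_rge0 _ (expR_gt0 (reflection c k q))).
rewrite -FE subr_ge0 -(F0 c k).
apply: (derive_ge0_le (f := F c k) (df := F' c k) q0) => x /andP[x0 _];
  first exact: is_derive_F.
by rewrite /F' mulr_ge0 ?expR_ge0 ?h.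
Qed.

Lemma hgap_reflection_ge c k q : 0 <= q ->
  (forall x, 0 <= x ->
    reflection' c k x * (kgap x - reflection c k x) + expR x - 1 <= 0) ->
  kgap q <= hgap (reflection c k q).
Proof.
move=> q0 h; rewrite -subr_le0 -(pmulr_rle0 _ (expR_gt0 (reflection c k q))).
rewrite -FE subr_le0 -(F0 c k) -lerN2.
apply: (derive_ge0_le (f := fun x => - F c k x) (df := fun x => - F' c k x) q0)
  => x /andP[x0 _].
  by apply: is_derive_opp; exact: is_derive_F.
by rewrite oppr_ge0 /F' mulr_ge0_le0 ?expR_ge0 ?h.
Qed.

Lemma hgap_reflection_23 q : 0 <= q ->
  hgap (reflection (2 / 3) 0 q) <= kgap q.
Proof.
move=> q0; apply: hgap_reflection_le => // x /exp_quadratic_ineq1 h.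
rewrite [leRHS](_ : _ = 2 / 9 *
  (expR x ^+ 2 + 4 * expR x - 5 - 4 * x * expR x - 2 * x)).
  by rewrite mulr_ge0// divr_ge0.
by rewrite /reflection' /reflection /kgap; field.
Qed.

(** Overshooting the exact coefficient [2 / 3] already reverses the
    inequality. *)
Lemma hgap_reflection_1 q : 0 <= q -> kgap q <= hgap (reflection 1 0 q).
Proof.
move=> q0; apply: hgap_reflection_ge => // x x0.
have := expR_ge1Dx (- x); have := expRxMexpNx_1 x; have := expR_gt0 x.
rewrite /reflection' /reflection /kgap.
set E := expR x; set E' := expR (- x) => E0 EE E'1; nra.
Qed.

(** The constant [4 / 81] is the largest one for which [gamma_median_lb3]
    holds at second order in [1 / a]. *)
Lemma hgap_reflection_quad q : 0 <= q ->
  kgap q <= hgap (reflection (2 / 3) (4 / 81) q).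
Proof.
move=> q0; apply: hgap_reflection_ge => // x x0.
have h := exp_quadratic_ineq2 x0; have k0 := kgap_ge0 x.
have E1 := expR_ge1Dx x.
rewrite [leLHS](_ : _ = - (2 / 81 * (expR x ^+ 2 * (4 * x - 7) -
    expR x * (4 * x ^+ 2 - 24 * x + 40) + (6 * x ^+ 2 + 26 * x + 47)) +
    2 * (4 / 81) ^+ 2 * (kgap x ^+ 3 * (expR x - 1)))).
  rewrite oppr_le0 addr_ge0// mulr_ge0// ?divr_ge0 ?mulr_ge0 ?exprn_ge0//.
  lra.
by rewrite /reflection' /reflection /kgap; field.
Qed.

End exp_inequalities.

(** * Bounds for the median of a gamma law *)

Lemma cube_le_affine (R : realFieldType) (u : R) : 0 <= u <= 1 / 3 ->
  (1 + u / 2 + u ^+ 2 / 3) ^+ 3 <= 1 + 6 * u.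
Proof.
move=> /andP[u0 u3]; have h1 : 1 + u / 2 + u ^+ 2 / 3 <= 1 + 11 / 18 * u by nra.
have h0 : 0 <= 1 + u / 2 + u ^+ 2 / 3 by nra.
apply: (@le_trans _ _ ((1 + 11 / 18 * u) ^+ 3)).
  by rewrite lerXn2r ?nnegrE//; lra.
rewrite !exprS expr0; nra.
Qed.

Lemma le_half_of_sub (R : realFieldType) (p q n t : R) :
  2 * p - n <= t -> q <= p - t / 2 -> q <= n / 2.
Proof. lra. Qed.

Lemma ge_half_of_sub (R : realFieldType) (p q n t : R) :
  t <= 2 * p - n -> p - t / 2 <= q -> n / 2 <= q.
Proof. lra. Qed.

Section gamma_median.
Context {R : realType} (a l : R).
Context (a0 : 0 < a) (l0 : 0 < l).
Implicit Types (c k q v x y : R).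

Let J := cumul (gamma_kernel a l).
Let N := total (gamma_kernel a l).
Let hJ := gamma_kernel_integrable a0 l0.

(* The mass below the point [exp (- v)] times the mean [a / l]; [M] is the
   largest value of its density with respect to [v], attained at the mean. *)
Let psi v := J (a / l * expR (- v)).
Let M := (a / l) `^ a * expR (- a).

Let al0 : 0 < a / l. Proof. exact: divr_gt0. Qed.

Let is_derive_psi v :
  is_derive v (1 : R) psi (- (M * expR (- (a * hgap v)))).
Proof.
have p0 : 0 < a / l * expR (- v) by rewrite mulr_gt0 ?expR_gt0.
have E := is_derive_exp (is_derive_opp (is_derive_id_pt v)).
apply: (is_derive_eq (is_derive_comp (g := fun v => a / l * expR (- v))
  (is_derive_cumul hJ p0) (is_derive_scale (a / l) E))).
rewrite /gamma_kernel /M.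
have -> : l * (a / l * expR (- v)) = a * expR (- v) by field; rewrite gt_eqF.
have E1 : expR (- a) * expR (- (a * hgap v)) =
    expR (- (a * v)) * expR (- (a * expR (- v))).
  by rewrite -!expRD; congr expR; rewrite /hgap; ring.
have P1 : (a / l * expR (- v)) `^ a = (a / l) `^ a * expR (- (a * v)).
  by rewrite powRM ?(ltW al0) ?expR_ge0// -expRM mulNr [v * a]mulrC.
rewrite -[in RHS]mulrA E1 [in RHS]mulrA -P1 -(mulr_powRB1 (ltW p0) a0); ring.
Qed.

Let M0 : 0 < M. Proof. by rewrite mulr_gt0 ?powR_gt0 ?expR_gt0. Qed.

Let psi_y (u : nat -> R) : u n @[n --> \oo] --> +oo ->
  psi (u n) @[n --> \oo] --> 0.
Proof.
move=> uy; have /cvg_at_rightP := cumul_cvg0 hJ.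
move=> /(_ (fun n => a / l * expR (- u n))); apply; split.
  by move=> n; rewrite mulr_gt0 ?expR_gt0.
rewrite -[X in _ --> X](mulr0 (a / l)); apply: cvgM; first exact: cvg_cst.
by have /cvg_pinftyP := @cvgr_expR R; apply.
Qed.

Let psi_Ny : psi (- n%:R) @[n --> \oo] --> N.
Proof.
have /cvg_pinftyP := cumul_cvgy hJ; apply.
apply/cvgryPge => A; near=> n; rewrite opprK.
have h : A / (a / l) <= n%:R by near: n; apply: nbhs_infty_ger; exact: num_real.
move: h; rewrite ler_pdivrMr// => /le_trans; apply.
rewrite mulrC ler_pM2l//; apply: le_trans (expR_ge1Dx _).
by rewrite lerDr.
Unshelve. all: by end_near. Qed.

(* A primitive of [(reflection' - 1) exp (- a kgap)]: this function is
   elementary because [reflection' - 1] is a polynomial in [kgap] times the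
   derivative of [kgap]. *)
Let W c k q := - (c / a + 2 * k * (kgap q / a + a^-1 ^+ 2)) * expR (- (a * kgap q)).

Let is_derive_W c k q : is_derive q (1 : R) (W c k)
  ((reflection' c k q - 1) * expR (- (a * kgap q))).
Proof.
have K := is_derive_kgap q.
have E := is_derive_exp (is_derive_opp (is_derive_scale a K)).
have h1 := is_derive_scale (2 * k) (is_derive_add
  (is_derive_mul K (is_derive_cst_pt a^-1 q)) (is_derive_cst_pt (a^-1 ^+ 2) q)).
have h2 := is_derive_opp (is_derive_add (is_derive_cst_pt (c / a) q) h1).
apply: (is_derive_eq (is_derive_mul h2 E)).
by rewrite /reflection'; field; rewrite gt_eqF.
Qed.

(* The mass between the point [reflection q] and the mean, minus the mass
   between the mean and the point [- q] on its other side. *)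
Let D c k q := psi 0 - psi (reflection c k q) - (psi (- q) - psi 0).
Let D' c k q := M * (expR (- (a * hgap (reflection c k q))) * reflection' c k q
  - expR (- (a * kgap q))).

Let is_derive_D c k q : is_derive q (1 : R) (D c k) (D' c k q).
Proof.
have h1 := is_derive_comp (is_derive_psi _) (is_derive_reflection c k q).
have h2 := is_derive_comp (is_derive_psi _) (is_derive_opp (is_derive_id_pt q)).
have c0 := is_derive_cst_pt (psi 0) q.
apply: (is_derive_eq (is_derive_sub (is_derive_sub c0 h1) (is_derive_sub h2 c0))).
by rewrite /D' hgapN; ring.
Qed.

Let D0 c k : D c k 0 = 0.
Proof. by rewrite /D reflection0 oppr0; ring. Qed.

Let reflection'_ge0 c k q : 0 <= c -> 0 <= k -> 0 <= q -> 0 <= reflection' c k q.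
Proof.
move=> c0 k0 q0; rewrite addr_ge0// mulr_ge0//.
  by rewrite addr_ge0// !mulr_ge0// kgap_ge0.
by rewrite subr_ge0 -(@expR0 R) ler_expR.
Qed.

Let le_reflection c k q : 0 <= c -> 0 <= k -> 0 <= q -> q <= reflection c k q.
Proof.
move=> c0 k0 q0; rewrite /reflection -addrA lerDl addr_ge0// mulr_ge0//.
  exact: kgap_ge0.
by rewrite sqr_ge0.
Qed.

Let D_cvg c k : 0 <= c -> 0 <= k ->
  D c k n%:R @[n --> \oo] --> psi 0 - (N - psi 0).
Proof.
move=> c0 k0; apply: cvgB; last first.
  by apply: cvgB; [exact: psi_Ny|exact: cvg_cst].
rewrite -[X in _ --> X]subr0; apply: cvgB; first exact: cvg_cst.
apply: psi_y; apply/cvgryPge => A; near=> n.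
apply: le_trans (le_reflection c0 k0 _) => //.
by near: n; apply: nbhs_infty_ger; exact: num_real.
Unshelve. all: by end_near. Qed.

(** [2 psi 0 - N] is the excess of the mass below the mean over the mass above
    it, the limit of [D]. When the reflection goes too far the density at the
    reflected point is the smaller one, so [D' <= M W'], and [W <= 0]
    leaves the bound [- M W(0)]. *)
Lemma reflection_upper c k : 0 <= c -> 0 <= k ->
  (forall q, 0 <= q -> kgap q <= hgap (reflection c k q)) ->
  2 * psi 0 - N <= M * (c / a + 2 * k / a ^+ 2).
Proof.
move=> c0 k0 h; have -> : 2 * psi 0 - N = psi 0 - (N - psi 0) by ring.
apply: (cvgr_to_le (D_cvg c0 k0)); apply: nearW => n.
have : 0 <= M * (W c k n%:R - W c k 0) - D c k n%:R.
  apply: (derive_ge0_ge0 (f := fun q => M * (W c k q - W c k 0) - D c k q)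
    (df := fun q => M * ((reflection' c k q - 1) * expR (- (a * kgap q))) - D' c
      k q) (ler0n R n)).
  - by rewrite D0; ring.
  - move=> q; apply: is_derive_sub; last exact: is_derive_D.
    apply: is_derive_scale; rewrite -[X in is_derive _ _ _ X]subr0.
    exact: (is_derive_sub (is_derive_W c k q) (is_derive_cst_pt _ q)).
  - move=> q q0; rewrite /D' -mulrBr mulr_ge0 ?(ltW M0)//.
    rewrite [leRHS](_ : _ = reflection' c k q *
      (expR (- (a * kgap q)) - expR (- (a * hgap (reflection c k q))))); last by ring.
    rewrite mulr_ge0 ?reflection'_ge0// subr_ge0 ler_expR lerN2 ler_pM2l//.
    exact: h.
rewrite subr_ge0 => /le_trans; apply; rewrite ler_pM2l//.
rewrite {2}/W kgap0 mulr0 oppr0 expR0 mulr1.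
rewrite [leLHS](_ : _ = W c k n%:R + (c / a + 2 * k / a ^+ 2)); last first.
  by field; rewrite gt_eqF.
rewrite gerDr /W mulNr oppr_le0 mulr_ge0 ?expR_ge0//.
rewrite addr_ge0 ?divr_ge0 ?(ltW a0)// mulr_ge0 ?mulr_ge0//.
by rewrite addr_ge0 ?sqr_ge0// divr_ge0 ?kgap_ge0// ltW.
Qed.

(** The opposite comparison, for a reflection that does not go far enough:
    here [D' >= M W'], and [W] vanishes at infinity. *)
Lemma reflection_lower c : 0 <= c ->
  (forall q, 0 <= q -> hgap (reflection c 0 q) <= kgap q) ->
  M * (c / a) <= 2 * psi 0 - N.
Proof.
move=> c0 h; have -> : 2 * psi 0 - N = psi 0 - (N - psi 0) by ring.
have -> : M * (c / a) = M * (0 + c / a) by rewrite add0r.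
have Wcvg : M * (W c 0 n%:R + c / a) @[n --> \oo] --> M * (0 + c / a).
  apply: cvgM; first exact: cvg_cst.
  apply: cvgD; last exact: cvg_cst.
  have -> : (fun n : nat => W c 0 n%:R) =
      (fun n => - (c / a) * expR (- (a * kgap n%:R))).
    by apply/funext => n; rewrite /W mulr0 mul0r addr0.
  rewrite -[X in _ --> X](mulr0 (- (c / a))); apply: cvgM; first exact: cvg_cst.
  have /cvg_pinftyP := @cvgr_expR R; apply.
  apply/cvgryPge => A; near=> n.
  have nA : A / a + 2 <= n%:R by near: n; apply: nbhs_infty_ger; exact: num_real.
  rewrite -ler_pdivrMl// mulrC.
  have n2 : 2 <= n%:R :> R by near: n; apply: nbhs_infty_ger; exact: num_real.
  have E1 := expR_ge1Dx (n%:R / 2 : R); have E2 := expRD (n%:R / 2 : R) (n%:R / 2).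
  have nn : n%:R / 2 + n%:R / 2 = n%:R :> R by field.
  rewrite nn in E2; rewrite /kgap E2; nra.
apply: (ler_cvg_to Wcvg (D_cvg c0 (lexx 0))); apply: nearW => n.
have : 0 <= D c 0 n%:R - M * (W c 0 n%:R - W c 0 0).
  apply: (derive_ge0_ge0 (f := fun q => D c 0 q - M * (W c 0 q - W c 0 0))
    (df := fun q => D' c 0 q - M * ((reflection' c 0 q - 1) * expR (- (a * kgap
      q)))) (ler0n R n)).
  - by rewrite D0; ring.
  - move=> q; apply: is_derive_sub; first exact: is_derive_D.
    apply: is_derive_scale; rewrite -[X in is_derive _ _ _ X]subr0.
    exact: (is_derive_sub (is_derive_W c 0 q) (is_derive_cst_pt _ q)).
  - move=> q q0; rewrite /D' -mulrBr mulr_ge0 ?(ltW M0)//.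
    rewrite [leRHS](_ : _ = reflection' c 0 q *
      (expR (- (a * hgap (reflection c 0 q))) - expR (- (a * kgap q)))); last by ring.
    rewrite mulr_ge0 ?reflection'_ge0// subr_ge0 ler_expR lerN2 ler_pM2l//.
    exact: h.
rewrite subr_ge0; apply: le_trans; rewrite ler_pM2l// lerD2l.
rewrite /W kgap0 !(mulr0, mul0r) oppr0 expR0 mulr1 addr0 opprK.
by [].
Unshelve. all: by end_near. Qed.

Let psi_le_sub (f df : R -> R) v : 0 <= v -> f 0 = 0 ->
  (forall x, is_derive x (1 : R) f (df x)) ->
  (forall x, 0 <= x -> df x <= expR (- (a * hgap x))) ->
  psi v <= psi 0 - M * f v.
Proof.
move=> v0 f0 fdf df0.
rewrite -subr_ge0 addrAC; apply: (derive_ge0_ge0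
  (f := fun x => psi 0 - psi x - M * f x)
  (df := fun x => M * (expR (- (a * hgap x)) - df x)) v0) => //.
- by rewrite f0 subrr mulr0 subr0.
- move=> x; have h := is_derive_sub (is_derive_cst_pt (psi 0) x) (is_derive_psi x).
  by apply: (is_derive_eq (is_derive_sub h (is_derive_scale M (fdf x)))); ring.
- by move=> x x0; rewrite mulr_ge0 ?(ltW M0)// subr_ge0 df0.
Qed.

(** The excess of the mass below the mean over one half is at least
    [M / (3 a)], and moving down from [v = 0] to [v = 1 / (3 a)] loses at most
    that much, since the density in [v] never exceeds [M]. *)
Lemma gamma_median_ub : N / 2 <= J (a / l * expR (- (1 / (3 * a)))).
Proof.
have h := reflection_lower (divr_ge0 (ler0n R 2) (ler0n R 3))
  (@hgap_reflection_23 R).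
set d := 1 / (3 * a).
have d0 : 0 <= d by rewrite divr_ge0// mulr_ge0// ltW.
have : psi 0 - M * d <= psi d.
  rewrite -subr_ge0; apply: (derive_ge0_ge0 (f := fun x => psi x - (psi 0 - M * x))
    (df := fun x => M * (1 - expR (- (a * hgap x)))) d0).
  - by rewrite mulr0; ring.
  - move=> x; have h1 := is_derive_scale M (is_derive_id_pt x).
    apply: (is_derive_eq (is_derive_sub (is_derive_psi x)
       (is_derive_sub (is_derive_cst_pt (psi 0) x) h1))); ring.
  - move=> x x0; rewrite mulr_ge0 ?(ltW M0)// subr_ge0 -[leRHS](@expR0 R).
    by rewrite ler_expR oppr_le0 mulr_ge0 ?hgap_ge0// ltW.
have -> : M * d = M * (2 / 3 / a) / 2 by rewrite /d; field; rewrite gt_eqF.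
exact: ge_half_of_sub h.
Qed.

(** The excess of the mass below the mean over one half is at most
    [M / (2 a)]. As [hgap v <= v], moving down to [v = ln 2 / a] loses at least
    the integral of [M exp (- a v)], which is exactly [M / (2 a)]. *)
Lemma gamma_median_lb : J (a / l * expR (- (ln 2 / a))) <= N / 2.
Proof.
have h := reflection_upper ler01 (lexx 0) (@hgap_reflection_1 R).
set d := ln 2 / a.
have d0 : 0 <= d by rewrite divr_ge0 ?(ltW a0)// ln_ge0// ler1n.
have : psi d <= psi 0 - M * (a^-1 - a^-1 * expR (- (a * d))).
  apply: (psi_le_sub (f := fun x => a^-1 - a^-1 * expR (- (a * x)))
    (df := fun x => expR (- (a * x))) d0).
  - by rewrite mulr0 oppr0 expR0; ring.
  - move=> x; have h1 := is_derive_scale a^-1 (is_derive_expRNM a x).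
    apply: (is_derive_eq (is_derive_sub (is_derive_cst_pt a^-1 x) h1)).
    by field; rewrite gt_eqF.
  - move=> x x0; rewrite ler_expR lerN2 ler_pM2l// /hgap addrAC gerDr subr_le0.
    by rewrite -[leRHS](@expR0 R) ler_expR oppr_le0.
have -> : a * d = ln 2 by rewrite /d; field; rewrite gt_eqF.
rewrite expRN lnK ?posrE//.
have -> : M * (a^-1 - a^-1 / 2) = M * (1 / a + 2 * 0 / a ^+ 2) / 2 by field;
  rewrite gt_eqF.
exact: le_half_of_sub h.
Qed.

Let hgap_le_half_sqr x : 0 <= x -> hgap x <= x ^+ 2 / 2.
Proof.
move=> x0; rewrite -subr_ge0.
apply: (derive_ge0_ge0 (f := fun x => x ^+ 2 / 2 - hgap x)
  (df := fun x => x - 1 + expR (- x)) x0).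
- by rewrite /hgap oppr0 expR0; ring.
- move=> y; have E := is_derive_exp (is_derive_opp (is_derive_id_pt y)).
  have h1 := is_derive_mul (is_derive_sqr (is_derive_id_pt y)) (is_derive_cst_pt (2^-1) y).
  have h2 := is_derive_sub (is_derive_add E (is_derive_id_pt y)) (is_derive_cst_pt 1 y).
  by apply: (is_derive_eq (is_derive_sub h1 h2)); field.
- by move=> y y0; have := expR_ge1Dx (- y); lra.
Qed.

(** With [u = 1 / (3 a)], the point [a - 1/3 = a (1 - u)] sits at
    [v = - ln (1 - u)], which exceeds the truncated series [L]. Between 0 and
    [L] the mass lost is at least [M (L - a L^3 / 6)] because
    [exp (- a v^2 / 2) >= 1 - a v^2 / 2]. What remains to be shown is a
    polynomial inequality in [u], from which [u^2] has cancelled thanks to the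
    coefficient [4 / 81] of the reflection. *)
Lemma gamma_median_lb3 : 1 <= a -> J ((a - 1 / 3) / l) <= N / 2.
Proof.
move=> a1; have h := reflection_upper (c := 2 / 3) (k := 4 / 81)
  (divr_ge0 (ler0n R 2) (ler0n R 3)) (divr_ge0 (ler0n R 4) (ler0n R 81))
    (@hgap_reflection_quad R).
pose u := 1 / (3 * a).
have u0 : 0 < u by rewrite divr_gt0// mulr_gt0.
have ua : a * u = 1 / 3 by rewrite /u; field; rewrite gt_eqF.
have u3 : u <= 1 / 3 by rewrite ler_pdivrMr ?mulr_gt0//; lra.
pose L := u + u ^+ 2 / 2 + u ^+ 3 / 3.
have u20 : 0 <= u ^+ 2 by exact: sqr_ge0.
have u30 : 0 <= u ^+ 3 by rewrite exprn_ge0// ltW.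
have L0 : 0 <= L by rewrite /L; lra.
(* L <= - ln (1 - u): the derivative of exp L (1 - u) in u is - exp L u^3 *)
have eL : expR L * (1 - u) <= 1.
  have dL x : is_derive x (1 : R) (fun x => x + x ^+ 2 / 2 + x ^+ 3 / 3)
      (1 + x + x ^+ 2).
    have d1 := is_derive_id_pt x; have d2 := is_derive_sqr d1.
    have -> : (fun x : R => x + x ^+ 2 / 2 + x ^+ 3 / 3) =
      (fun x => x + 2^-1 * x ^+ 2 + 3^-1 * (x * x ^+ 2)).
      by apply/funext => y; field.
    apply: (is_derive_eq (is_derive_add (is_derive_add d1 (is_derive_scale 2^-1 d2))
      (is_derive_scale 3^-1 (is_derive_mul d1 d2)))).
    by field.
  rewrite -subr_ge0; apply: (derive_ge0_ge0
    (f := fun x => 1 - expR (x + x ^+ 2 / 2 + x ^+ 3 / 3) * (1 - x))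
    (df := fun x => expR (x + x ^+ 2 / 2 + x ^+ 3 / 3) * x ^+ 3) (ltW u0)).
  - by rewrite !expr0n /= !mul0r !addr0 expR0; ring.
  - move=> x; have d1 := is_derive_sub (is_derive_cst_pt 1 x) (is_derive_id_pt x).
    have d2 := is_derive_mul (is_derive_exp (dL x)) d1.
    by apply: (is_derive_eq (is_derive_sub (is_derive_cst_pt 1 x) d2)); ring.
  - by move=> x x0; rewrite mulr_ge0 ?expR_ge0// exprn_ge0.
have psiL : psi L <= psi 0 - M * (L - a * L ^+ 3 / 6).
  apply: (psi_le_sub (f := fun x => x - a * x ^+ 3 / 6)
    (df := fun x => 1 - a * (x ^+ 2 / 2)) L0).
  - by rewrite expr0n /=; ring.
  - move=> x; have d1 := is_derive_id_pt x; have d2 := is_derive_sqr d1.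
    have -> : (fun x : R => x - a * x ^+ 3 / 6) = (fun x => x - a / 6 * (x * x ^+ 2)).
      by apply/funext => y; field.
    apply: (is_derive_eq (is_derive_sub d1 (is_derive_scale (a / 6)
      (is_derive_mul d1 d2)))).
    by field.
  - move=> x x0; apply: le_trans (expR_ge1Dx _).
    by rewrite lerD2l lerN2 ler_pM2l// hgap_le_half_sqr.
have key : (2 / 3) / a + 2 * (4 / 81) / a ^+ 2 <= 2 * (L - a * L ^+ 3 / 6).
  have -> : a = 1 / (3 * u) by rewrite /u; field; rewrite gt_eqF.
  rewrite -subr_ge0.
  have -> : 2 * (L - 1 / (3 * u) * L ^+ 3 / 6) -
     (2 / 3 / (1 / (3 * u)) + 2 * (4 / 81) / (1 / (3 * u)) ^+ 2) =
     u ^+ 2 / 9 * (1 + 6 * u - (1 + u / 2 + u ^+ 2 / 3) ^+ 3).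
    by rewrite /L; field; rewrite gt_eqF.
  rewrite mulr_ge0 ?divr_ge0// subr_ge0.
  by rewrite cube_le_affine// (ltW u0).
have a3l : 0 < (a - 1 / 3) / l.
  by rewrite divr_gt0// subr_gt0 (lt_le_trans _ a1)// ltr_pdivrMr// mul1r ltr1n.
have mono : J ((a - 1 / 3) / l) <= psi L.
  apply: (@derive_ge0_le _ J (gamma_kernel a l)).
  - have -> : (a - 1 / 3) / l = a / l * (1 - u) by rewrite /u; field; rewrite !gt_eqF.
    by rewrite ler_pM2l// expRN -[leRHS]mul1r ler_pdivlMr ?expR_gt0// mulrC.
  - move=> x /andP[+ _]; move=> /(lt_le_trans _) x0; apply: is_derive_cumul => //.
    exact: x0 a3l.
  - move=> x /andP[+ _]; move=> /(lt_le_trans _) x0; apply: ltW;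
      apply: gamma_kernel_gt0.
    exact: x0 a3l.
apply: (le_trans mono); apply: (le_half_of_sub h); apply: (le_trans psiL).
by rewrite lerD2l lerN2 ler_pdivrMr// -[leRHS]mulrA ler_pM2l// [leRHS]mulrC.
Qed.

End gamma_median.

(** * The entire part of the modified Bessel function *)

(** In this lemma and the next, [u = z B / (2 A)] satisfies
    [u^2 + 2 (a / z) u < 1], whence [u <= 1] and, with [s = a / z],
    [u <= sqrt (1 + s^2) - s <= 1 - s + s^2 / 2]. *)
Lemma root_le1 (R : realFieldType) (A B a z : R) :
  0 < z -> 0 < A -> 0 <= B -> 0 <= a ->
  a * A * B + z ^+ 2 / 4 * B ^+ 2 < A ^+ 2 -> z / 2 * B <= A.
Proof.
move=> z0 A0 B0 a0 h; have zB0 : 0 <= z / 2 * B.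
  by apply: mulr_ge0 B0; apply: divr_ge0 => //; exact: ltW.
have AB0 : 0 <= a * A * B by apply: mulr_ge0 B0; exact: mulr_ge0 a0 (ltW A0).
rewrite -ler_sqr ?nnegrE ?(ltW A0)//; apply: ltW; apply: le_lt_trans h.
rewrite [leLHS](_ : _ = z ^+ 2 / 4 * B ^+ 2); last by field.
by rewrite lerDr.
Qed.

Lemma root_le_taylor (R : realFieldType) (A B a z : R) : 0 < z -> 0 < A -> 0 <= B
  -> 0 <= a ->
  a * A * B + z ^+ 2 / 4 * B ^+ 2 < A ^+ 2 ->
  0 <= A - z / 2 * B - a / z * A + a ^+ 2 / (2 * z ^+ 2) * A.
Proof.
move=> z0 A0 B0 a0 h.
pose u := z * B / (2 * A); pose t := a / z.
have zn : z != 0 by rewrite gt_eqF.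
have An : A != 0 by rewrite gt_eqF.
have u0 : 0 <= u by rewrite divr_ge0 ?mulr_ge0// ltW.
have t0 : 0 <= t by rewrite divr_ge0// ltW.
have ut : u ^+ 2 + 2 * t * u < 1.
  rewrite -(ltr_pM2r (exprn_gt0 2 A0)) mul1r (le_lt_trans _ h)// le_eqVlt.
  by apply/orP; left; apply/eqP; rewrite /u /t; field; rewrite An zn.
rewrite [leRHS](_ : _ = A * (1 - u - t + t ^+ 2 / 2)).
  apply: mulr_ge0; [exact: ltW|nra].
by rewrite /u /t; field; rewrite An zn.
Qed.

(** [I_m (z) = (z / 2)^m besselB m (z^2 / 4)]. Without the power the function is
    smooth at 0, and its derivative is the same function of order [m + 1]. *)
Definition besselB_coef {R : realType} (m : R) (n : nat) : R :=
  (n`!%:R * Gamma (m + n%:R + 1))^-1.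

Definition besselB_series {R : realType} (m w : R) : R :=
  limn (pseries (besselB_coef m) w).

(** Locked, so that comparing two values compares their arguments. *)
Definition besselB {R : realType} : R -> R -> R := locked besselB_series.

Lemma besselBE {R : realType} :
  besselB = fun m w : R => limn (pseries (besselB_coef m) w).
Proof. by rewrite /besselB -lock. Qed.

Section bessel.
Context {R : realType}.
Implicit Types (m w x y z : R) (n : nat).

Local Opaque Gamma.

Lemma besselB_coef_gt0 m n : - (1 / 2) < m -> 0 < besselB_coef m n.
Proof.
move=> m2; rewrite invr_gt0 mulr_gt0 ?ltr0n ?fact_gt0// Gamma_gt0//.
have := ler0n R n; lra.
Qed.

Lemma besselB_coefS m n : - (1 / 2) < m ->
  besselB_coef m n = (m + n%:R + 1) * besselB_coef (m + 1) n.
Proof.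
move=> m2; have n0 := ler0n R n; have s0 : 0 < m + n%:R + 1 by lra.
rewrite /besselB_coef (_ : m + 1 + n%:R + 1 = (m + n%:R + 1) + 1); last by ring.
by rewrite (GammaS s0) (mulrCA n`!%:R) [in RHS]invfM mulVKf// gt_eqF.
Qed.

Lemma besselB_coef_diffs m :
  pseries_diffs (besselB_coef m) = besselB_coef (m + 1).
Proof.
apply/funext => n; rewrite /pseries_diffs /besselB_coef factS natrM.
have -> : m + n.+1%:R + 1 = m + 1 + n%:R + 1 by rewrite -natr1; ring.
move: (Gamma _) (n`!%:R : R) => g p.
by rewrite -mulrA invfM mulVKf// pnatr_eq0.
Qed.

(** [Gamma (m + n + 1)] is multiplied by at least [1/2] at each step, so that an
    exponential series dominates. *)
Lemma besselB_coef_le m n : - (1 / 2) < m ->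
  besselB_coef m n <= (Gamma (m + 1))^-1 * (2 ^+ n / n`!%:R).
Proof.
move=> m2; have m1 : 0 < m + 1 by lra.
have Gm : Gamma (m + 1) / 2 ^+ n <= Gamma (m + n%:R + 1).
  elim: n => [|n IHn]; first by rewrite expr0 divr1 addr0.
  have n0 := ler0n R n.
  rewrite (_ : m + n.+1%:R + 1 = (m + n%:R + 1) + 1); last by rewrite -natr1; ring.
  have s0 : 0 < m + n%:R + 1 by lra.
  rewrite (GammaS s0).
  have G0 := ltW (Gamma_gt0 m1); have s2 : 2^-1 <= m + n%:R + 1 by lra.
  move: IHn G0; move: (Gamma _) (Gamma _) => g h gh g0.
  rewrite exprSr invfM mulrA mulrC; apply: ler_pM => //.
  by rewrite divr_ge0// exprn_ge0.
rewrite /besselB_coef;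
  have G0 : 0 < Gamma (m + 1) / 2 ^+ n by rewrite divr_gt0 ?exprn_gt0 ?Gamma_gt0.
have f0 : 0 < n`!%:R :> R by rewrite ltr0n fact_gt0.
move: Gm G0; move: (Gamma _) (Gamma _) (n`!%:R) f0 => h g p p0 gh g0.
rewrite invfM mulrC mulrA ler_pM2r ?invr_gt0//.
apply: (@le_trans _ _ (g / 2 ^+ n)^-1).
  by rewrite lef_pV2 ?posrE// (lt_le_trans g0 gh).
by rewrite invfM invrK.
Qed.

Lemma besselB_cvg m w : - (1 / 2) < m -> 0 <= w ->
  cvgn (pseries (besselB_coef m) w).
Proof.
move=> m2 w0; have m1 : 0 < m + 1 by lra.
apply: (@series_le_cvg _ _ ((Gamma (m + 1))^-1 *: exp_coeff (2 * w))).
- by move=> n; rewrite mulr_ge0 ?exprn_ge0// ltW// besselB_coef_gt0.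
- move=> n; rewrite /exp_coeff /= mulr_ge0 ?invr_ge0 ?(ltW (Gamma_gt0 m1))//.
  by rewrite divr_ge0// exprn_ge0// mulr_ge0.
- move=> n; rewrite /exp_coeff /=.
  rewrite [leRHS](_ : _ = (Gamma (m + 1))^-1 * (2 ^+ n / n`!%:R) * w ^+ n).
    by rewrite ler_wpM2r ?exprn_ge0// besselB_coef_le.
  by rewrite /GRing.scale /= exprMn /GRing.scale /= [X in _ * X = _]mulrAC !mulrA.
- exact/is_cvg_seriesZ/is_cvg_series_exp_coeff.
Qed.

Lemma is_derive_besselB m w : - (1 / 2) < m ->
  is_derive w (1 : R) (besselB m) (besselB (m + 1) w).
Proof.
move=> m2; have m12 : - (1 / 2) < m + 1 by lra.
have m22 : - (1 / 2) < m + 1 + 1 by lra.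
rewrite besselBE -besselB_coef_diffs.
have w10 : 0 <= `|w| + 1 by rewrite addr_ge0.
apply: (@pseries_snd_diffs _ _ (`|w| + 1)).
- exact: besselB_cvg.
- by rewrite besselB_coef_diffs; exact: besselB_cvg.
- by rewrite !besselB_coef_diffs; exact: besselB_cvg.
- by rewrite [ltRHS]ger0_norm// ltrDl.
Qed.

(** The recurrence [I_m - I_(m+2) = (2 (m + 1) / z) I_(m+1)], coefficient by
    coefficient. *)
Lemma besselB_rec m w : - (1 / 2) < m -> 0 <= w ->
  besselB m w = (m + 1) * besselB (m + 1) w + w * besselB (m + 1 + 1) w.
Proof.
move=> m2 w0; have m12 : - (1 / 2) < m + 1 by lra.
have m22 : - (1 / 2) < m + 1 + 1 by lra.
have c1 := besselB_cvg m12 w0; have c2 := besselB_cvg m22 w0.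
have := @pseries_diffs_equiv _ (besselB_coef (m + 1)) w.
rewrite besselB_coef_diffs => /(_ c2) h.
have h1 : cvgn (series (fun i => i%:R * besselB_coef (m + 1) i * w ^+ i.-1)).
  exact: cvgP h.
set u := fun i : nat => besselB_coef (m + 1) i * w ^+ i.
set v := fun i : nat => i%:R * besselB_coef (m + 1) i * w ^+ i.-1.
have -> : (m + 1) * besselB (m + 1) w = limn (series ((m + 1) *: u)).
  by rewrite besselBE (lim_seriesZ (m + 1) c1).
have -> : w * besselB (m + 1 + 1) w = limn (series (w *: v)).
  by rewrite besselBE (lim_seriesZ w h1) (cvg_lim _ h).
rewrite -(lim_seriesD (is_cvg_seriesZ c1) (is_cvg_seriesZ h1)).
rewrite besselBE /pseries; congr (limn (series _)); apply/funext => n.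
transitivity ((m + 1) * u n + w * v n) => //.
rewrite /u /v /= (besselB_coefS n m2); move: (besselB_coef (m + 1) n) => b.
case: n => [|n] /=; first by rewrite mulr0n; ring.
by rewrite exprS; move: (w ^+ n) n.+1%:R => p k; ring.
Qed.

Lemma besselB_ge0 m w : - (1 / 2) < m -> 0 <= w -> 0 <= besselB m w.
Proof.
move=> m2 w0; rewrite besselBE; apply: limr_ge; first exact: besselB_cvg.
apply: nearW => n; rewrite /pseries /= /series /= sumr_ge0// => i _.
by rewrite mulr_ge0 ?exprn_ge0// ltW// besselB_coef_gt0.
Qed.

Lemma besselB_gt0 m w : - (1 / 2) < m -> 0 <= w -> 0 < besselB m w.
Proof.
move=> m2 w0; apply: (@lt_le_trans _ _ (besselB_coef m 0)).
  exact: besselB_coef_gt0.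
rewrite besselBE; apply: limr_ge; first exact: besselB_cvg.
exists 1%N => // n /= n0; rewrite /pseries /series /= -(prednK n0) big_nat_recl//=.
rewrite expr0 mulr1 lerDl sumr_ge0// => i _.
by rewrite mulr_ge0 ?exprn_ge0// ltW// besselB_coef_gt0.
Qed.

Lemma besselIE m x : - (1 / 2) < m -> 0 < x ->
  besselI m x = (x / 2) `^ m * besselB m (x ^+ 2 / 4).
Proof.
move=> m2 x0; have x20 : 0 < x / 2 by rewrite divr_gt0.
have x40 : 0 <= x ^+ 2 / 4 by rewrite divr_ge0// sqr_ge0.
rewrite besselBE -[RHS]lim_seriesZ; last exact: besselB_cvg.
congr (limn (series _)); apply/funext => n; rewrite /GRing.scale /= /GRing.scale /=.
rewrite powRD; last by rewrite (gt_eqF x20) implybT.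
rewrite -natrM powR_mulrn ?(ltW x20)// exprM /besselB_coef.
have -> : (x / 2) ^+ 2 = x ^+ 2 / 4 by field.
by move: ((x ^+ 2 / 4) ^+ n) => p; ring.
Qed.

(** A bound of Amos type for the ratio [I_(m+1) / I_m]. If [T] is the difference
    of the two sides and [r = m + 1/2], then [w^r T] vanishes at 0 and, by the
    recurrence, has the derivative [(r / 2) w^(r-1) B_m B_(m+1)], which is
    positive. *)
Lemma besselB_amos m w : - (1 / 2) < m -> 0 < w ->
  (m + 1 / 2) * besselB m w * besselB (m + 1) w + w * besselB (m + 1) w ^+ 2
    < besselB m w ^+ 2.
Proof.
move=> m2; set r := m + 1 / 2.
have r0 : 0 < r by rewrite /r; lra.
have m12 : - (1 / 2) < m + 1 by lra.
pose T x := besselB m x ^+ 2 - (r * (besselB m x * besselB (m + 1) x)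
  + x * besselB (m + 1) x ^+ 2).
pose dT x := 2 * besselB m x * besselB (m + 1) x - (r *
   (besselB (m + 1) x * besselB (m + 1) x + besselB m x * besselB (m + 1 + 1) x)
  + (1 * besselB (m + 1) x ^+ 2 +
    x * (2 * besselB (m + 1) x * besselB (m + 1 + 1) x))).
have dTE x : is_derive x (1 : R) T (dT x).
  have A := is_derive_besselB x m2; have B := is_derive_besselB x m12.
  exact: (is_derive_sub (is_derive_sqr A) (is_derive_add
    (is_derive_scale r (is_derive_mul A B))
    (is_derive_mul (is_derive_id_pt x) (is_derive_sqr B)))).
pose G x := x `^ r * T x.
pose dG x := r / 2 * x `^ (r - 1) * (besselB m x * besselB (m + 1) x).
have dGE x : 0 < x -> is_derive x (1 : R) G (dG x).
  move=> x0; apply: (is_derive_eq (is_derive_mul (is_derive_powR r x0) (dTE x))).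
  have hC : x * besselB (m + 1 + 1) x = besselB m x - (m + 1) * besselB (m + 1) x.
    by apply/eqP; rewrite eq_sym subr_eq addrC -besselB_rec// ltW.
  rewrite -(mulr_powRB1 (ltW x0) r0) /T /dT /dG.
  set P := x `^ (r - 1); set A := besselB m x; set B := besselB (m + 1) x.
  rewrite -/A -/B in hC.
  transitivity (P * (r * (A ^+ 2 - (r * (A * B) + x * B ^+ 2)) +
     (2 * x * A * B - x * r * B ^+ 2 - r * A * (x * besselB (m + 1 + 1) x)
      - x * B ^+ 2 - 2 * x * B * (x * besselB (m + 1 + 1) x)))); first ring.
  by rewrite hC /r; field.
have dG0 x : 0 < x -> 0 < dG x.
  move=> x0; rewrite mulr_gt0//; first by rewrite mulr_gt0 ?powR_gt0// divr_gt0.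
  by rewrite mulr_gt0// besselB_gt0// ltW.
have G0 : G x @[x --> 0^'+] --> 0.
  rewrite -[X in _ --> X](mul0r (T 0)); apply: cvgM; first exact: powR_cvg0.
  by apply: cvg_at_right_filter; exact: is_derive_continuous (dTE 0).
move=> w0; have w20 : 0 < w / 2 by rewrite divr_gt0.
have : 0 < G w.
  apply: (@le_lt_trans _ _ (G (w / 2))).
    by apply: (derive_ge0_cvg_le w20 dGE _ G0) => y /dG0/ltW.
  apply: (derive_gt0_lt (df := dG)).
  - by rewrite ltr_pdivrMr// mulr_natr mulr2n ltrDl.
  - by move=> y /andP[/(lt_le_trans w20) y0 _]; exact: dGE.
  - by move=> y /andP[/(lt_trans w20) y0 _]; exact: dG0.
by rewrite pmulr_rgt0 ?powR_gt0// subr_gt0 /T mulrA.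
Qed.

Lemma is_derive_besselB_sqr m z : - (1 / 2) < m ->
  is_derive z (1 : R) (fun z => besselB m (z ^+ 2 / 4))
    (besselB (m + 1) (z ^+ 2 / 4) * (z / 2)).
Proof.
move=> m2.
have h1 := is_derive_mul (is_derive_sqr (is_derive_id_pt z)) (is_derive_cst_pt (4^-1) z).
have h2 := is_derive_besselB (z ^+ 2 / 4) m2.
apply: (is_derive_eq (is_derive_comp (g := fun z : R => z ^+ 2 / 4) h2 h1)).
by field.
Qed.

Lemma besselB_ratio_le1 m z : - (1 / 2) < m -> 0 < z ->
  z / 2 * besselB (m + 1) (z ^+ 2 / 4) <= besselB m (z ^+ 2 / 4).
Proof.
move=> m2 z0; have w0 : 0 < z ^+ 2 / 4 by rewrite divr_gt0// exprn_gt0.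
have m12 : - (1 / 2) < m + 1 by lra.
have r0 : 0 < m + 1 / 2 by lra.
have A0 := besselB_gt0 m2 (ltW w0); have B0 := besselB_gt0 m12 (ltW w0).
exact: root_le1 z0 A0 (ltW B0) (ltW r0) (besselB_amos m2 w0).
Qed.

(** [exp (- z) B_m (z^2 / 4)] is nonincreasing, since [I_(m+1) <= I_m]. *)
Lemma besselB_le_exp m z : - (1 / 2) < m -> 0 <= z ->
  besselB m (z ^+ 2 / 4) <= besselB m 0 * expR z.
Proof.
move=> m2 z0.
suff : - (expR (- 0) * besselB m (0 ^+ 2 / 4)) <= - (expR (- z) * besselB m (z ^+ 2 / 4)).
  rewrite lerN2 oppr0 expR0 expr0n /= !mul0r mul1r expRN.
  by rewrite mulrC ler_pdivrMr ?expR_gt0.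
have dE y : is_derive y (1 : R) (fun z => - (expR (- z) * besselB m (z ^+ 2 / 4)))
   (expR (- y) * (besselB m (y ^+ 2 / 4) - y / 2 * besselB (m + 1) (y ^+ 2 / 4))).
  have h1 := is_derive_exp (is_derive_opp (is_derive_id_pt y)).
  have h2 := is_derive_besselB_sqr y m2.
  by apply: (is_derive_eq (is_derive_opp (is_derive_mul h1 h2))); ring.
apply: (derive_ge0_le z0 (fun y _ => dE y)) => y /andP[y0 _].
rewrite mulr_ge0 ?expR_ge0// subr_ge0.
move: y0; rewrite le_eqVlt => /predU1P[<-|y0]; last exact: besselB_ratio_le1.
by rewrite !mul0r besselB_ge0// expr0n /= mul0r.
Qed.

(** Up to the factor [2^m], this is [sqrt z exp (- z) I_m (z)], whose
    convergence at infinity governs the case of [c] close to 1. *)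
Definition besselL m z : R :=
  z `^ (m + 1 / 2) * expR (- z) * besselB m (z ^+ 2 / 4).

(* [besselL] itself need not be monotone. The correcting factor, which tends
   to 1, makes the sign of the derivative a consequence of [besselB_amos]. *)
Let H m z := besselL m z * expR ((m + 1 / 2) ^+ 2 / (2 * z)).

Let H_nonincreasing m x y : - (1 / 2) < m -> 0 < x -> x <= y -> H m y <= H m x.
Proof.
move=> m2 x0 xy; rewrite -lerN2; set r := m + 1 / 2.
have r0 : 0 < r by rewrite /r; lra.
have m12 : - (1 / 2) < m + 1 by lra.
pose dH z := z `^ r * expR (- z) * expR (r ^+ 2 / (2 * z)) *
  (besselB m (z ^+ 2 / 4) - z / 2 * besselB (m + 1) (z ^+ 2 / 4)
   - r / z * besselB m (z ^+ 2 / 4) + r ^+ 2 / (2 * z ^+ 2) * besselB m (z ^+ 2 / 4)).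
apply: (derive_ge0_le (f := fun z => - H m z) (df := dH) xy) => z /andP[xz _].
  have z0 := lt_le_trans x0 xz; have zn : z != 0 by rewrite gt_eqF.
  have d1 := is_derive_powR r z0.
  have d2 := is_derive_exp (is_derive_opp (is_derive_id_pt z)).
  have d3 := is_derive_besselB_sqr z m2.
  have z2n : 2 * z != 0 by rewrite mulf_neq0.
  have d4 := is_derive_exp (is_derive_scale (r ^+ 2)
    (is_derive_inv (f := fun z => 2 * z) z2n (is_derive_scale 2 (is_derive_id_pt z)))).
  apply: (is_derive_eq (is_derive_opp (is_derive_mul (is_derive_mul
    (is_derive_mul d1 d2) d3) d4))).
  rewrite /dH -(mulr_powRB1 (ltW z0) r0); field.
  by rewrite zn.
have z0 := lt_le_trans x0 xz.
have w0 : 0 < z ^+ 2 / 4 by rewrite divr_gt0// exprn_gt0.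
rewrite mulr_ge0 ?mulr_ge0 ?powR_ge0 ?expR_ge0//.
apply: root_le_taylor; rewrite ?besselB_gt0 ?besselB_ge0 ?(ltW w0) ?(ltW r0)//.
exact: besselB_amos.
Qed.

Lemma besselL_ge0 m z : - (1 / 2) < m -> 0 <= besselL m z.
Proof.
by move=> m2; rewrite mulr_ge0 ?mulr_ge0 ?powR_ge0 ?expR_ge0// besselB_ge0//
  divr_ge0 ?sqr_ge0.
Qed.

Lemma besselL_bounded m : - (1 / 2) < m ->
  exists2 M, 0 <= M & forall z, 0 < z -> besselL m z <= M.
Proof.
move=> m2; have r0 : 0 <= m + 1 / 2 by lra.
have B0 : 0 <= besselB m 0 by exact: besselB_ge0.
have H0 : 0 <= H m 1 by rewrite mulr_ge0 ?expR_ge0 ?besselL_ge0.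
exists (besselB m 0 + H m 1); first exact: addr_ge0.
move=> z z0; have [z1|z1] := leP z 1.
  rewrite (@le_trans _ _ (besselB m 0)) ?lerDl//.
  have zr : z `^ (m + 1 / 2) <= 1.
    have := ge0_ler_powR r0 (ltW z0 : z \in Num.nneg) (ler01 : 1 \in Num.nneg) z1.
    by rewrite powR1.
  rewrite /besselL -mulrA (@le_trans _ _ (1 * besselB m 0))//; last by rewrite mul1r.
  apply: ler_pM => //; first exact: powR_ge0.
    by rewrite mulr_ge0 ?expR_ge0 ?besselB_ge0// divr_ge0 ?sqr_ge0.
  by rewrite expRN mulrC ler_pdivrMr ?expR_gt0// besselB_le_exp// ltW.
rewrite (@le_trans _ _ (H m 1)) ?lerDr//.
apply: le_trans (H_nonincreasing m2 ltr01 (ltW z1)).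
rewrite /H ler_peMr ?besselL_ge0//.
apply: (le_trans _ (expR_ge1Dx _)); rewrite lerDl divr_ge0 ?sqr_ge0//.
by rewrite mulr_ge0// ltW.
Qed.

Lemma besselL_cvg m : - (1 / 2) < m ->
  exists l : R, besselL m z @[z --> +oo] --> l.
Proof.
move=> m2; pose f z := - H m (Num.max 1 z).
have f_nd : {homo f : x y / x <= y}.
  move=> x y xy; rewrite lerN2 H_nonincreasing// ?lt_max ?ltr01//.
  by rewrite ge_max le_max lexx /= le_max xy orbT.
have H0 z : 0 <= H m z by rewrite mulr_ge0 ?expR_ge0 ?besselL_ge0.
have f_ub : has_ubound (range f).
  by exists 0 => _ [z _ <-]; rewrite oppr_le0.
have fl := nondecreasing_cvgr f_nd f_ub.
exists (- sup (range f) * 1).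
have El : expR (- ((m + 1 / 2) ^+ 2 / (2 * z))) @[z --> +oo] --> (1 : R).
  rewrite -[X in _ --> X](@expR0 R); apply: continuous_cvg;
    first exact: continuous_expR.
  rewrite -[X in _ --> X]oppr0; apply: cvgN.
  have V : (fun z : R => (2 * z)^-1) @ +oo --> (0 : R).
    apply/gtr0_cvgV0; last exact: gt0_cvgMry (ltr0n _ 2) cvg_id.
    by exists 0; split=> // z z0; exact: mulr_gt0.
  rewrite -[X in _ --> X](mulr0 ((m + 1 / 2) ^+ 2)).
  by apply: cvgM; [exact: cvg_cst|exact: V].
apply: cvg_trans (cvgM (cvgN fl) El); apply: near_eq_cvg; near=> z.
have z1 : 1 <= z by near: z; apply: nbhs_pinfty_ge; exact: num_real.
rewrite fctE /f /= opprK (max_idPr z1) /H -mulrA -expRD subrr expR0 mulr1.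
by [].
Unshelve. all: by end_near. Qed.

End bessel.

(** * The McKay kernel and its flux *)

(** If [A <= (t y / 2) B] then
    [A (A - r B) <= (t y / 2) (t y / 2 - r) B^2], and this is at most
    [y^2 (t^2 - t) / 4 B^2] exactly when [y <= 2 r], against the hypothesis. *)
Lemma flux_root_pos (R : realFieldType) (A B r t y : R) :
  0 < A -> 0 < B -> 0 < r -> 1 < t -> 0 < y -> y <= 2 * r ->
  r * A * B + y ^+ 2 * (t ^+ 2 - t) / 4 * B ^+ 2 < A ^+ 2 ->
  0 < 2 * A - t * y * B.
Proof.
move=> A0 B0 r0 t1 y0 yr h; rewrite ltNge; apply/negP => hA.
have t0 : 0 < t by rewrite (lt_trans _ t1).
have ty : 0 < t * y by rewrite mulr_gt0.
have B20 : 0 < B ^+ 2 by rewrite exprn_gt0.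
have [Ar|Ar] := leP A (r * B).
  have h1 : A ^+ 2 <= r * A * B by rewrite expr2 mulrAC mulrC [leRHS]mulrC ler_pM2l.
  have h2 : 0 <= y ^+ 2 * (t ^+ 2 - t) / 4 * B ^+ 2.
    apply: mulr_ge0 (ltW B20); apply: divr_ge0 => //; apply: mulr_ge0;
      first exact: sqr_ge0.
    by rewrite subr_ge0 expr2 ler_peMr ?ltW.
  lra.
have hA2 : A <= t * y / 2 * B by lra.
have h1 : A * (A - r * B) <= (t * y / 2 * B) * (t * y / 2 * B - r * B).
  apply: ler_pM => //; [exact: ltW| |]; lra.
have h2 : (t * y / 2 * B) * (t * y / 2 * B - r * B) - y ^+ 2 * (t ^+ 2 - t) / 4 * B ^+ 2
   = - (B ^+ 2 * (t * y) / 4 * (2 * r - y)) by field.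
have h3 : 0 <= B ^+ 2 * (t * y) / 4 * (2 * r - y).
  apply: mulr_ge0; last by rewrite subr_ge0.
  by apply: divr_ge0 => //; apply: mulr_ge0; exact: ltW.
lra.
Qed.

(** One half of a decay [exp (- y / 2)] absorbs the polynomial growth in [y] of
    the derivative of the kernel. *)
Lemma quadratic_le_expR (R : realType) (y : R) : 0 <= y ->
  1 + y + y ^+ 2 <= 48 * expR (y / 4).
Proof.
move=> y0; have y4 : 0 <= y / 4 by rewrite divr_ge0.
have h1 := expR_ge1Dx (y / 4); have h2 := expR_ge1Dxn 1 y4.
rewrite (_ : 2`!%:R = 2 :> R) // expr_div_n in h2; lra.
Qed.

(** The algebra behind [mckay_kernel_dt_bound], with the special functions
    abstracted: [e] and [e4] stand for [exp (- y / 2)] and [exp (- y / 4)], half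
    of the decay being spent on the quadratic growth in [y]. *)
Lemma mckay_dt_estimate (R : realFieldType)
    (q t v y T V p A B k k' E e e4 : R) : 0 <= q -> 1 <= t -> t <= v -> 0 < y ->
  0 <= A -> 0 <= B -> 0 <= k -> 0 <= k' -> 0 <= p -> 0 <= T -> T <= V ->
  0 <= e -> 0 <= E -> E * A <= k * e -> E * B <= k' * e ->
  (1 + y + y ^+ 2) * e <= 48 * e4 ->
  `|T * (p * E) * ((q - t * y) * A + t * (2 * t - 1) * y ^+ 2 / 4 * B)|
   <= V * (q + v + v ^+ 2) * (k + k') * 48 * (p * e4).
Proof.
move=> q0 t1 tv y0 A0 B0 k0 k0' p0 T0 TV e0 E0 EA EB ee.
have t0 : 0 <= t by rewrite (le_trans _ t1).
have v0 : 0 <= v by rewrite (le_trans t0).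
have ke0 : 0 <= (k + k') * e by rewrite mulr_ge0// addr_ge0.
pose S := q + v + v ^+ 2.
have S0 : 0 <= S by rewrite !addr_ge0// sqr_ge0.
have c1 : `|q - t * y| <= S * (1 + y).
  by rewrite ler_norml; apply/andP; split; rewrite /S; nra.
have c2 : 0 <= t * (2 * t - 1) * y ^+ 2 / 4 by nra.
have c3 : t * (2 * t - 1) * y ^+ 2 / 4 <= S * y ^+ 2.
  have h : t * (2 * t - 1) / 4 <= S by rewrite /S; nra.
  by rewrite mulrAC; apply: ler_wpM2r => //; exact: sqr_ge0.
have EA' : E * A <= (k + k') * e by rewrite (le_trans EA)// ler_wpM2r// lerDl.
have EB' : E * B <= (k + k') * e by rewrite (le_trans EB)// ler_wpM2r// lerDr.
have EA0 : 0 <= E * A by exact: mulr_ge0.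
have EB0 : 0 <= E * B by exact: mulr_ge0.
have main : `|(q - t * y) * (E * A) + t * (2 * t - 1) * y ^+ 2 / 4 * (E * B)|
    <= S * (k + k') * (48 * e4).
  apply: (le_trans (ler_normD _ _)).
  rewrite normrM (ger0_norm EA0) (ger0_norm (mulr_ge0 c2 EB0)).
  apply: (@le_trans _ _ (S * (1 + y) * ((k + k') * e) + S * y ^+ 2 * ((k + k') * e))).
    by apply: lerD; apply: ler_pM.
  rewrite [leLHS](_ : _ = S * (k + k') * ((1 + y + y ^+ 2) * e)); last by ring.
  by apply: ler_wpM2l => //; rewrite mulr_ge0// addr_ge0.
rewrite [X in `|X|](_ : _ = T * p * ((q - t * y) * (E * A) +
   t * (2 * t - 1) * y ^+ 2 / 4 * (E * B))); last by ring.
rewrite normrM ger0_norm ?mulr_ge0//.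
rewrite [leRHS](_ : _ = V * p * (S * (k + k') * (48 * e4))); last by rewrite /S; ring.
by apply: ler_pM => //; [exact: mulr_ge0|exact: ler_wpM2r].
Qed.

Lemma powR_addr1 (R : realType) (y k : R) : 0 < y -> y `^ (k + 1) = y * y `^ k.
Proof.
move=> y0; rewrite powRD; last by rewrite (gt_eqF y0) implybT.
by rewrite (powRr1 (ltW y0)) mulrC.
Qed.

Section mckay.
Context {R : realType} (m : R).
Context (m2 : - (1 / 2) < m).
Implicit Types (c l t v x y : R) (n : nat).
Notation mu := (@lebesgue_measure R).

Let m12 : - (1 / 2) < m + 1. Proof. have := m2; lra. Qed.
Let a0 : 0 < 2 * m + 1. Proof. have := m2; lra. Qed.
Let r := m + 1 / 2.
Let r0 : 0 < r. Proof. have := m2; rewrite /r; lra. Qed.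

(** For [t = c^2 / (c^2 - 1)], the McKay density in the unit [phi], up to a
    factor independent of [c]. The argument of [besselB] comes from
    [(c / (c^2 - 1))^2 = t^2 - t]. *)
Definition mckay_kernel t y : R :=
  t `^ (m + 1 / 2) * gamma_kernel (2 * m + 1) t y
    * besselB m (y ^+ 2 * (t ^+ 2 - t) / 4).

Definition mckay_kernel_dt t y : R :=
  t `^ (m + 1 / 2 - 1) * gamma_kernel (2 * m + 1) t y *
  ((m + 1 / 2 - t * y) * besselB m (y ^+ 2 * (t ^+ 2 - t) / 4)
   + t * (2 * t - 1) * y ^+ 2 / 4 * besselB (m + 1) (y ^+ 2 * (t ^+ 2 - t) / 4)).

Definition mckay_flux t y : R :=
  t `^ (m + 1 / 2 - 1) / 4 * gamma_kernel (2 * m + 1 + 1) t y *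
  (2 * besselB m (y ^+ 2 * (t ^+ 2 - t) / 4)
   - t * y * besselB (m + 1) (y ^+ 2 * (t ^+ 2 - t) / 4)).

Lemma is_derive_mckay_kernel_dt t y : 0 < t -> 0 < y ->
  is_derive t (1 : R) (mckay_kernel ^~ y) (mckay_kernel_dt t y).
Proof.
move=> t0 y0; have d1 := is_derive_powR r t0.
have d2 : is_derive t (1 : R) (fun t => gamma_kernel (2 * m + 1) t y)
    (- y * gamma_kernel (2 * m + 1) t y).
  have -> : (fun t => gamma_kernel (2 * m + 1) t y) =
      (fun t => y `^ (2 * m + 1 - 1) * expR (- (y * t))).
    by apply/funext => z; rewrite /gamma_kernel [z * y]mulrC.
  apply: (is_derive_eq (is_derive_scale _ (is_derive_expRNM y t))).
  by rewrite /gamma_kernel [t * y]mulrC; ring.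
have d3 : is_derive t (1 : R) (fun t => y ^+ 2 * (t ^+ 2 - t) / 4)
   (y ^+ 2 * (2 * t - 1) / 4).
  have h := is_derive_sub (is_derive_sqr (is_derive_id_pt t)) (is_derive_id_pt t).
  apply: (is_derive_eq (is_derive_mul (is_derive_scale (y ^+ 2) h)
    (is_derive_cst_pt (4^-1) t))).
  by field.
have d4 := is_derive_comp (g := fun t => y ^+ 2 * (t ^+ 2 - t) / 4)
  (is_derive_besselB (y ^+ 2 * (t ^+ 2 - t) / 4) m2) d3.
apply: (is_derive_eq (is_derive_mul (is_derive_mul d1 d2) d4)).
rewrite /mckay_kernel_dt -(mulr_powRB1 (ltW t0) r0) -/r; by field.
Qed.

Let w_derive t y : is_derive y (1 : R) (fun y => y ^+ 2 * (t ^+ 2 - t) / 4)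
   (y * (t ^+ 2 - t) / 2).
Proof.
have h := is_derive_mul (is_derive_sqr (is_derive_id_pt y))
  (is_derive_cst_pt (t ^+ 2 - t) y).
apply: (is_derive_eq (is_derive_mul h (is_derive_cst_pt (4^-1) y))).
by field.
Qed.

Let B_derive k t y : - (1 / 2) < k ->
  is_derive y (1 : R) (fun y => besselB k (y ^+ 2 * (t ^+ 2 - t) / 4))
   (besselB (k + 1) (y ^+ 2 * (t ^+ 2 - t) / 4) * (y * (t ^+ 2 - t) / 2)).
Proof.
move=> k2.
exact: (is_derive_comp (g := fun y => y ^+ 2 * (t ^+ 2 - t) / 4)
  (is_derive_besselB _ k2) (w_derive t y)).
Qed.

Lemma is_derive_gamma_kernel k l y : 0 < y ->
  is_derive y (1 : R) (gamma_kernel (k + 1) l)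
    ((k - l * y) * gamma_kernel k l y).
Proof.
move=> y0.
apply: (is_derive_eq (is_derive_mul (is_derive_powR (k + 1 - 1) y0)
  (is_derive_expRNM l y))).
rewrite /gamma_kernel addrK; have -> : y `^ k = y * y `^ (k - 1).
  by rewrite -(powR_addr1 _ y0) subrK.
ring.
Qed.

Let w_ge0 t y : 1 <= t -> 0 <= y ^+ 2 * (t ^+ 2 - t) / 4.
Proof.
move=> t1; apply: divr_ge0 => //; apply: mulr_ge0; first exact: sqr_ge0.
by rewrite subr_ge0 expr2 ler_peMr// (le_trans _ t1).
Qed.

(** The conservation law on which the monotonicity rests: the flux is a
    primitive in [y] of the derivative of the kernel in [t]. The recurrence
    eliminates the Bessel function of order [m + 2]. *)
Lemma is_derive_mckay_flux t y : 1 <= t -> 0 < y ->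
  is_derive y (1 : R) (mckay_flux t) (mckay_kernel_dt t y).
Proof.
move=> t1 y0; have t0 : 0 < t by rewrite (lt_le_trans _ t1).
have d1 := is_derive_gamma_kernel (2 * m + 1) t y0.
have d2 := is_derive_scale 2 (B_derive t y m2).
have d3 := is_derive_mul (is_derive_scale t (is_derive_id_pt y)) (B_derive t y m12).
have wt := w_ge0 y t1.
apply: (is_derive_eq (is_derive_mul
  (is_derive_scale (t `^ (m + 1 / 2 - 1) / 4) d1) (is_derive_sub d2 d3))).
have gS : gamma_kernel (2 * m + 1 + 1) t y = y * gamma_kernel (2 * m + 1) t y.
  by rewrite /gamma_kernel !addrK mulrA -(powR_addr1 _ y0).
rewrite gS /mckay_kernel_dt.
have hC := besselB_rec m2 wt.
set A := besselB m _ in hC *; set B := besselB (m + 1) _ in hC *.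
set C := besselB (m + 1 + 1) _ in hC *.
move: (gamma_kernel _ _ _) (t `^ _) => g T.
by rewrite hC; field.
Qed.

(** The argument is [(s y)^2 / 4] with [s = sqrt (t^2 - t) <= t - 1/2]: the
    growth [exp (s y)] of the Bessel factor leaves a decay [exp (- y / 2)]
    uniform in [t]. *)
Lemma exp_besselB_bound k t y : - (1 / 2) < k -> 1 <= t -> 0 <= y ->
  expR (- (t * y)) * besselB k (y ^+ 2 * (t ^+ 2 - t) / 4)
   <= besselB k 0 * expR (- (1 / 2 * y)).
Proof.
move=> k2 t1 y0; pose s := Num.sqrt (t ^+ 2 - t).
have tt0 : 0 <= t ^+ 2 - t by rewrite subr_ge0 expr2 ler_peMr// (le_trans _ t1).
have s2 : s ^+ 2 = t ^+ 2 - t by rewrite sqr_sqrtr.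
have s0 : 0 <= s by exact: sqrtr_ge0.
have -> : y ^+ 2 * (t ^+ 2 - t) / 4 = (s * y) ^+ 2 / 4.
  by rewrite -s2; field.
have st : s <= t - 1 / 2.
  by rewrite -ler_sqr ?nnegrE//; [rewrite s2|]; nra.
apply: (@le_trans _ _ (expR (- (t * y)) * (besselB k 0 * expR (s * y)))).
  by apply: ler_wpM2l; [exact: expR_ge0|apply: besselB_le_exp => //; exact: mulr_ge0].
rewrite mulrCA -expRD; apply: ler_wpM2l; first exact: besselB_ge0.
by rewrite ler_expR; nra.
Qed.

Lemma mckay_kernel_gt0 t y : 1 <= t -> 0 < y -> 0 < mckay_kernel t y.
Proof.
move=> t1 y0; have t0 : 0 < t by rewrite (lt_le_trans _ t1).
apply: mulr_gt0; last exact: besselB_gt0 (w_ge0 _ _).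
by apply: mulr_gt0; [exact: powR_gt0|exact: gamma_kernel_gt0].
Qed.

Lemma mckay_kernel_bound t y : 1 <= t -> 0 < y ->
  mckay_kernel t y <=
    t `^ (m + 1 / 2) * besselB m 0 * gamma_kernel (2 * m + 1) (1 / 2) y.
Proof.
move=> t1 y0; have h := exp_besselB_bound m2 t1 (ltW y0).
rewrite /mckay_kernel /gamma_kernel; move: h.
have := powR_ge0 y (2 * m + 1 - 1); have := powR_ge0 t (m + 1 / 2).
move: (besselB m 0) (expR (- (1 / 2 * y))) (besselB m _) (expR _) (y `^ _) (t `^ _).
move=> k e A E p q q0 p0 h; rewrite [leLHS](_ : _ = q * p * (E * A)); last by ring.
rewrite [leRHS](_ : _ = q * p * (k * e)); last by ring.
by apply: ler_wpM2l => //; exact: mulr_ge0.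
Qed.

Lemma mckay_kernel_continuous t y : 0 < y -> {for y, continuous (mckay_kernel t)}.
Proof.
move=> y0; apply: (is_derive_continuous (f := mckay_kernel t)).
have d1 := is_derive_gamma_kernel (2 * m) t y0.
exact: (is_derive_mul (is_derive_scale (t `^ (m + 1 / 2)) d1) (B_derive t y m2)).
Qed.

Lemma mckay_kernel_integrable t : 1 <= t -> halfline_integrable (mckay_kernel t).
Proof.
move=> t1; have l0 : 0 < 1 / 2 :> R by rewrite divr_gt0.
apply: (halfline_dominated (C := t `^ (m + 1 / 2) * besselB m 0)
  (gamma_kernel_integrable a0 l0)) => y y0; first exact: mckay_kernel_continuous.
by rewrite gtr0_norm ?mckay_kernel_gt0// mckay_kernel_bound.
Qed.

Lemma mckay_kernel_dt_continuous t y : 0 < y ->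
  {for y, continuous (mckay_kernel_dt t)}.
Proof.
move=> y0; apply: (is_derive_continuous (f := mckay_kernel_dt t)).
have d1 := is_derive_gamma_kernel (2 * m) t y0.
have d2 := is_derive_sub (is_derive_cst_pt (m + 1 / 2) y)
  (is_derive_scale t (is_derive_id_pt y)).
have d3 := is_derive_mul (is_derive_scale (t * (2 * t - 1))
  (is_derive_sqr (is_derive_id_pt y))) (is_derive_cst_pt (4^-1) y).
exact: (is_derive_mul (is_derive_scale (t `^ (m + 1 / 2 - 1)) d1)
  (is_derive_add (is_derive_mul d2 (B_derive t y m2))
    (is_derive_mul d3 (B_derive t y m12)))).
Qed.

Let Kdt v := v `^ r * (r + v + v ^+ 2) * (besselB m 0 + besselB (m + 1) 0) * 48.

Lemma mckay_kernel_dt_bound t v y : 1 <= t -> t <= v -> 0 < y ->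
  `|mckay_kernel_dt t y| <= Kdt v * gamma_kernel (2 * m + 1) (1 / 4) y.
Proof.
move=> t1 tv y0; have t0 : 0 < t by rewrite (lt_le_trans _ t1).
have v1 : 1 <= v := le_trans t1 tv; have v0 : 0 < v := lt_le_trans t0 tv.
have hA := exp_besselB_bound m2 t1 (ltW y0).
have hB := exp_besselB_bound m12 t1 (ltW y0).
have A0 := besselB_ge0 m2 (w_ge0 y t1); have B0 := besselB_ge0 m12 (w_ge0 y t1).
have tr : t `^ (r - 1) <= v `^ r.
  apply: (@le_trans _ _ (t `^ r)).
    by apply: ler_powR => //; rewrite gerBl.
  by apply: ge0_ler_powR => //; rewrite ?nnegrE; exact: ltW.
rewrite /mckay_kernel_dt /gamma_kernel -/r.
have p0 : 0 <= y `^ (2 * m + 1 - 1) by exact: powR_ge0.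
have c1 : 0 <= t `^ (r - 1) by exact: powR_ge0.
have e0 : 0 <= expR (- (1 / 2 * y)) by exact: expR_ge0.
have k0 : 0 <= besselB m 0 by exact: besselB_ge0.
have k1 : 0 <= besselB (m + 1) 0 by exact: besselB_ge0.
have ee : (1 + y + y ^+ 2) * expR (- (1 / 2 * y)) <= 48 * expR (- (1 / 4 * y)).
  have -> : - (1 / 4 * y) = y / 4 + - (1 / 2 * y) by field.
  rewrite expRD mulrA; apply: ler_wpM2r => //.
  exact: quadratic_le_expR (ltW y0).
have r0' := ltW r0; have v0' := ltW v0; have y0' := ltW y0; have t0' := ltW t0.
have Ee := expR_ge0 (- (t * y)).
rewrite /Kdt; move: hA hB A0 B0 k0 k1 tr p0 c1 e0 ee Ee; rewrite -/r.
set A := besselB m (y ^+ 2 * _ / 4); set B := besselB (m + 1) (y ^+ 2 * _ / 4).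
move: A B (besselB m 0) (besselB (m + 1) 0) (t `^ (r - 1)) (v `^ r)
  (y `^ (2 * m + 1 - 1)) (expR (- (t * y))) (expR (- (1 / 2 * y)))
  (expR (- (1 / 4 * y))) => A B k k' T V p E e e4 hA hB A0 B0 k0 k1 TV p0 T0 e0 ee E0.
move: r r0' => q q0.
exact: (mckay_dt_estimate (e := e)).
Qed.

Lemma mckay_kernel_dt_integrable t : 1 <= t -> halfline_integrable (mckay_kernel_dt t).
Proof.
move=> t1; have l0 : 0 < 1 / 4 :> R by rewrite divr_gt0.
apply: (halfline_dominated (C := Kdt t)
  (gamma_kernel_integrable a0 l0)) => y y0; first exact: mckay_kernel_dt_continuous.
exact: mckay_kernel_dt_bound.
Qed.

Lemma mckay_flux_cvg0 t : mckay_flux t y @[y --> 0^'+] --> 0.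
Proof.
pose g y := t `^ (m + 1 / 2 - 1) / 4 * expR (- (t * y)) *
  (2 * besselB m (y ^+ 2 * (t ^+ 2 - t) / 4)
   - t * y * besselB (m + 1) (y ^+ 2 * (t ^+ 2 - t) / 4)).
have -> : mckay_flux t = (fun y => y `^ (2 * m + 1) * g y).
  apply/funext => y; rewrite /mckay_flux /g /gamma_kernel addrK.
  by move: (besselB _ _) (besselB _ _) (expR _) (_ `^ _) (_ `^ _) => *; ring.
have d1 := is_derive_scale (t `^ (m + 1 / 2 - 1) / 4) (is_derive_expRNM t 0).
have d2 := is_derive_scale 2 (B_derive t 0 m2).
have d3 := is_derive_mul (is_derive_scale t (is_derive_id_pt 0)) (B_derive t 0 m12).
have gc : {for 0, continuous g}.
  exact: is_derive_continuous (is_derive_mul d1 (is_derive_sub d2 d3)).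
rewrite -[X in _ --> X](mul0r (g 0)); apply: cvgM; first exact: powR_cvg0.
exact: cvg_at_right_filter gc.
Qed.

Lemma cumul_mckay_kernel_dt t x : 1 <= t -> 0 < x ->
  cumul (mckay_kernel_dt t) x = mckay_flux t x.
Proof.
move=> t1 x0.
apply: (cumul_unique (F := mckay_flux t) (mckay_kernel_dt_integrable t1) x0).
  by move=> y y0; exact: is_derive_mckay_flux.
exact: mckay_flux_cvg0.
Qed.

(** Differentiation under the integral sign on [1 < t' < t + 1], where the
    derivatives in [t'] have a common gamma majorant. *)
Lemma is_derive_cumul_mckay t x : 1 < t -> 0 < x ->
  is_derive t (1 : R) (fun t => cumul (mckay_kernel t) x) (mckay_flux t x).
Proof.
move=> t1 x0; rewrite -(cumul_mckay_kernel_dt (ltW t1) x0).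
have l0 : 0 < 1 / 4 :> R by rewrite divr_gt0.
pose I : set R := [set` `]1, t + 1[].
have It : I t by rewrite /I /= in_itv /= t1 ltrDl ltr01.
have I1 z : I z -> 1 <= z /\ z <= t + 1.
  by rewrite /I /= in_itv /= => /andP[/ltW ? /ltW].
pose D : set R := [set` `]0, x]].
have D0 z : D z -> 0 < z by rewrite /D /= in_itv /= => /andP[].
have dE z y : I z -> D y ->
    is_derive z (1 : R) (mckay_kernel ^~ y) (mckay_kernel_dt z y).
  move=> /I1[z1 _] /D0 y0; apply: is_derive_mckay_kernel_dt y0.
  exact: lt_le_trans z1.
have pE z y : I z -> D y -> partial1of2 mckay_kernel z y = mckay_kernel_dt z y.
  by move=> Iz Dy; rewrite partial1of2E; case: (dE z y Iz Dy).
have gi := gamma_kernel_integrable a0 l0.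
have K0 : 0 <= Kdt (t + 1).
  have t10 : 0 <= t + 1 by rewrite addr_ge0// (le_trans ler01) ?ltW.
  apply: mulr_ge0 => //; apply: mulr_ge0; last first.
    by apply: addr_ge0; exact: besselB_ge0.
  apply: mulr_ge0; first exact: powR_ge0.
  by apply: addr_ge0; [apply: addr_ge0 => //; exact: ltW|exact: sqr_ge0].
pose G y := Kdt (t + 1) * gamma_kernel (2 * m + 1) (1 / 4) y.
have iG : mu.-integrable D (EFin \o G).
  have hG : halfline_integrable G.
    apply: (halfline_dominated (C := Kdt (t + 1)) gi) => y y0.
      by apply: cvgM; [exact: cvg_cst|exact: gamma_kernel_continuous].
    by rewrite ger0_norm// mulr_ge0// ltW// gamma_kernel_gt0.
  exact: cumul_integrable hG.
have cv : h^-1 *: (cumul (mckay_kernel (h + t)) x - cumul (mckay_kernel t) x)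
    @[h --> 0^'] --> cumul (mckay_kernel_dt t) x.
  have -> : cumul (mckay_kernel_dt t) x =
      \int[mu]_(y in D) partial1of2 mckay_kernel t y.
    by apply: eq_Rintegral => y /set_mem Dy; rewrite pE.
  apply: (@cvg_differentiation_under_integral _ _ _ mu mckay_kernel D
    (measurable_itv _) t 1 (t + 1) It _ _ G _ iG).
  - by move=> z /I1[z1 _]; exact: cumul_integrable (mckay_kernel_integrable z1).
  - by move=> z y Iz Dy; case: (dE z y Iz Dy).
  - move=> y; apply: mulr_ge0 => //; apply: mulr_ge0; first exact: powR_ge0.
    exact: expR_ge0.
  - move=> z y Iz Dy; rewrite pE//; have [z1 zt] := I1 z Iz.
    exact: mckay_kernel_dt_bound z1 zt (D0 y Dy).
have shE : (fun h => h^-1 *: (cumul (mckay_kernel (h%:A + t)) x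
    - cumul (mckay_kernel t) x)) =
    (fun h => h^-1 *: (cumul (mckay_kernel (h + t)) x - cumul (mckay_kernel t) x)).
  by apply/funext => h; rewrite [h%:A]mulr1.
apply: DeriveDef.
- by apply/cvg_ex; exists (cumul (mckay_kernel_dt t) x); rewrite shE.
- by apply: cvg_lim => //; rewrite shE.
Qed.

End mckay.

(** * The two gamma limits of the McKay kernel *)

Section limits.
Context {R : realType}.
Implicit Types (c l m t v x y : R) (n : nat).
Notation mu := (@lebesgue_measure R).

Lemma cumul_dominated (fn : nat -> R -> R) (f g : R -> R) C :
  halfline_integrable g ->
  (forall n y, 0 < y -> {for y, continuous (fn n)}) ->
  (forall y, 0 < y -> {for y, continuous f}) ->
  (forall n y, 0 < y -> `|fn n y| <= C * g y) ->
  (forall y, 0 < y -> fn n y @[n --> \oo] --> f y) ->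
  (forall x, cumul (fn n) x @[n --> \oo] --> cumul f x) /\
  total (fn n) @[n --> \oo] --> total f.
Proof.
move=> [cg ig] cfn cf fng fnf.
have hCg : halfline_integrable (fun y => C * g y).
  split; first by move=> y y0; apply: cvgM; [exact: cvg_cst|exact: cg].
  exact: (@integrableZl _ _ _ mu _ _ C (EFin \o g)).
have mf := halfline_measurable cf.
have mfn n := halfline_measurable (cfn n).
split=> [x|].
  apply: (@dominated_Rintegral _ _ _ _ (fun y => C * g y)) => //.
  - by move=> n; apply: measurable_funS (mfn n) => //; exact: halfline_sub.
  - by apply: measurable_funS mf => //; exact: halfline_sub.
  - exact: cumul_integrable hCg.
  - by move=> n y; rewrite /= in_itv /= => /andP[y0 _]; exact: fng.
  - by move=> y; rewrite /= in_itv /= => /andP[y0 _]; exact: fnf.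
apply: (@dominated_Rintegral _ _ _ _ (fun y => C * g y)) => //.
- exact: hCg.2.
- by move=> n y; rewrite /= in_itv /= andbT => y0; exact: fng.
- by move=> y; rewrite /= in_itv /= andbT => y0; exact: fnf.
Qed.

Lemma cvg_harmonicS : (1 : R) + n.+1%:R^-1 @[n --> \oo] --> (1 : R).
Proof.
rewrite -[X in _ --> X]addr0; apply: cvgD; first exact: cvg_cst.
exact: cvg_harmonic.
Qed.

Lemma harmonicS_bounds n : 1 < 1 + n.+1%:R^-1 :> R /\ 1 + n.+1%:R^-1 <= 2 :> R.
Proof.
split; first by rewrite ltrDl invr_gt0.
by rewrite (_ : 2 = 1 + 1)// lerD2l invf_le1// ler1n.
Qed.

End limits.

Section mckay_limits.
Context {R : realType} (m : R).
Context (m2 : - (1 / 2) < m).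
Implicit Types (c l t v x y : R) (n : nat).

Let a0 : 0 < 2 * m + 1. Proof. have := m2; lra. Qed.
Let r0 : 0 < m + 1 / 2. Proof. have := m2; lra. Qed.
Let half0 : 0 < 1 / 2 :> R. Proof. by rewrite divr_gt0. Qed.

Lemma mckay_flux_gt0 t y : 1 < t -> 0 < y -> y <= 2 * m + 1 -> 0 < mckay_flux m t y.
Proof.
move=> t1 y0 ya; have t0 : 0 < t by rewrite (lt_trans _ t1).
have w0 : 0 < y ^+ 2 * (t ^+ 2 - t) / 4.
  rewrite divr_gt0// mulr_gt0 ?exprn_gt0// subr_gt0 expr2.
  by rewrite -[ltLHS]mul1r ltr_pM2r.
have m12 : - (1 / 2) < m + 1 by rewrite (lt_trans m2)// ltrDl.
apply: mulr_gt0.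
  by apply: mulr_gt0; [rewrite divr_gt0// powR_gt0|exact: gamma_kernel_gt0].
apply: (flux_root_pos _ _ r0 t1 y0 _ (besselB_amos m2 w0)).
- exact: besselB_gt0 m2 (ltW w0).
- exact: besselB_gt0 m12 (ltW w0).
- by rewrite (_ : 2 * (m + 1 / 2) = 2 * m + 1)//; field.
Qed.

Lemma cumul_mckay_lt t t' x : 1 < t -> t < t' -> 0 < x -> x <= 2 * m + 1 ->
  cumul (mckay_kernel m t) x < cumul (mckay_kernel m t') x.
Proof.
move=> t1 tt' x0 xa.
apply: (derive_gt0_lt (f := fun t => cumul (mckay_kernel m t) x)
  (df := mckay_flux m ^~ x) tt').
  by move=> z /andP[/(lt_le_trans t1) z1 _]; exact: is_derive_cumul_mckay.
by move=> z /andP[/(lt_trans t1) z1 _]; exact: mckay_flux_gt0.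
Qed.

(** At [t = 1] the argument of the Bessel factor vanishes and the kernel is a
    multiple of a gamma kernel; for [1 <= t <= 2] it has a common majorant. *)
Lemma mckay_kernel_cvg1 :
  (forall x, cumul (mckay_kernel m (1 + n.+1%:R^-1)) x @[n --> \oo] -->
     besselB m 0 * cumul (gamma_kernel (2 * m + 1) 1) x) /\
  total (mckay_kernel m (1 + n.+1%:R^-1)) @[n --> \oo] -->
     besselB m 0 * total (gamma_kernel (2 * m + 1) 1).
Proof.
have gi := gamma_kernel_integrable a0 (@ltr01 R).
have [|||| hc ht] := @cumul_dominated R (fun n => mckay_kernel m (1 + n.+1%:R^-1))
  (fun y => besselB m 0 * gamma_kernel (2 * m + 1) 1 y) _ (2 `^ (m + 1 / 2) * besselB m 0)
  (gamma_kernel_integrable a0 half0).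
- by move=> n y y0; exact: mckay_kernel_continuous.
- by move=> y y0; apply: cvgM; [exact: cvg_cst|exact: gamma_kernel_continuous].
- move=> n y y0; have [/ltW t1 t2] := @harmonicS_bounds R n.
  rewrite gtr0_norm ?mckay_kernel_gt0//.
  apply: (le_trans (mckay_kernel_bound m2 t1 y0)).
  apply: ler_wpM2r; first exact/ltW/gamma_kernel_gt0.
  apply: ler_wpM2r; first exact: besselB_ge0.
  by apply: (ge0_ler_powR (ltW r0)) t2; rewrite nnegrE// (le_trans ler01 t1).
- move=> y y0.
  have -> : besselB m 0 * gamma_kernel (2 * m + 1) 1 y = mckay_kernel m 1 y.
    by rewrite /mckay_kernel powR1 mul1r expr1n subrr mulr0 mul0r mulrC.
  have h := is_derive_continuous (is_derive_mckay_kernel_dt m2 ltr01 y0).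
  exact: (cvg_comp _ _ (@cvg_harmonicS R) h).
have E0 x : besselB m 0 * cumul (gamma_kernel (2 * m + 1) 1) x =
    cumul (fun y => besselB m 0 * gamma_kernel (2 * m + 1) 1 y) x.
  by rewrite /cumul RintegralZl//; exact: cumul_integrable.
split; first by move=> x; rewrite E0; exact: hc.
by rewrite /total -RintegralZl//; exact: gi.2.
Qed.

(** The exponent splits as [c^2 / (c^2 - 1) = c / (c + 1) + c / (c^2 - 1)]; its
    second part and half of the power of [y] are absorbed by [besselL]. *)
Lemma mckay_kernel_besselL c y : 1 < c -> 0 < y ->
  mckay_kernel m (c ^+ 2 / (c ^+ 2 - 1)) y =
  c `^ (m + 1 / 2) * gamma_kernel (m + 1 / 2) (c / (c + 1)) y
    * besselL m (c / (c ^+ 2 - 1) * y).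
Proof.
move=> c1 y0; have c0 : 0 < c by rewrite (lt_trans _ c1).
have cc0 : 0 < c ^+ 2 - 1 by rewrite subr_gt0 -[ltLHS](expr1n R 2) ltrXn2r// nnegrE ltW.
have ccn : c ^+ 2 - 1 != 0 by rewrite gt_eqF.
have cp : c + 1 != 0 by rewrite gt_eqF// addr_gt0.
have s0 : 0 < c / (c ^+ 2 - 1) by rewrite divr_gt0.
rewrite /mckay_kernel /besselL /gamma_kernel.
have -> : (c / (c ^+ 2 - 1) * y) ^+ 2 / 4 =
    y ^+ 2 * ((c ^+ 2 / (c ^+ 2 - 1)) ^+ 2 - c ^+ 2 / (c ^+ 2 - 1)) / 4 by field.
have -> : c ^+ 2 / (c ^+ 2 - 1) * y = c / (c + 1) * y + c / (c ^+ 2 - 1) * y.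
  by field; rewrite ccn cp.
have -> : c ^+ 2 / (c ^+ 2 - 1) = c * (c / (c ^+ 2 - 1)) by field.
rewrite opprD expRD !powRM ?invr_ge0 ?(ltW cc0) ?(ltW s0) ?(ltW c0) ?(ltW y0)//.
have -> : y `^ (2 * m + 1 - 1) = y `^ (m + 1 / 2 - 1) * y `^ (m + 1 / 2).
  rewrite -powRD ?(gt_eqF y0) ?implybT//; congr (_ `^ _); by field.
move: (besselB _ _) (expR _) (expR _) => B E1 E2.
move: (c `^ _) (_^-1 `^ _) (y `^ (m + 1 / 2 - 1)) (y `^ (m + 1 / 2)) => *; ring.
Qed.

(** Along [c = 1 + 1 / (n + 1)] the argument of [besselL] tends to infinity and
    the rate [c / (c + 1)] to [1/2], from above, so that a multiple of the limit
    kernel is a majorant. *)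
Lemma mckay_kernel_cvgy : exists2 l : R, 0 <= l &
  (forall x, cumul (mckay_kernel m
      ((1 + n.+1%:R^-1) ^+ 2 / ((1 + n.+1%:R^-1) ^+ 2 - 1))) x @[n --> \oo] -->
     l * cumul (gamma_kernel (m + 1 / 2) (1 / 2)) x) /\
  total (mckay_kernel m
      ((1 + n.+1%:R^-1) ^+ 2 / ((1 + n.+1%:R^-1) ^+ 2 - 1))) @[n --> \oo] -->
     l * total (gamma_kernel (m + 1 / 2) (1 / 2)).
Proof.
have [l Ll] := besselL_cvg m2; have [M M0 LM] := besselL_bounded m2.
have l0 : 0 <= l.
  by apply: (cvgr_to_ge Ll); apply: nearW => z; exact: besselL_ge0.
exists l => //.
have gi := gamma_kernel_integrable r0 half0.
pose c n : R := 1 + n.+1%:R^-1.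
have c1 n : 1 < c n by have [] := @harmonicS_bounds R n.
have c2 n : c n <= 2 by have [] := @harmonicS_bounds R n.
have c0 n : 0 < c n := lt_trans ltr01 (c1 n).
have cc0 n : 0 < c n ^+ 2 - 1.
  by rewrite subr_gt0 -[ltLHS](expr1n R 2) ltrXn2r// nnegrE ltW.
have ccvg : c n @[n --> \oo] --> (1 : R) by exact: cvg_harmonicS.
have s0 n : 0 < c n / (c n ^+ 2 - 1) by rewrite divr_gt0.
have scvg y : 0 < y -> c n / (c n ^+ 2 - 1) * y @[n --> \oo] --> +oo.
  move=> y0; apply/cvgryPge => A; near=> n.
  rewrite -ler_pdivrMr//; apply: (@le_trans _ _ (n.+1%:R / 3)); last first.
    have n0 : n.+1%:R != 0 :> R by rewrite pnatr_eq0.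
    have nn : (1 : R) <= n.+1%:R by rewrite ler1n.
    rewrite ler_pdivlMr// /c.
    have : (n.+1%:R^-1 : R) <= 1 by rewrite invf_le1.
    have : n.+1%:R * n.+1%:R^-1 = 1 :> R by rewrite divff.
    have : 0 < n.+1%:R^-1 :> R by rewrite invr_gt0.
    by move: (n.+1%:R : R) (n.+1%:R^-1 : R) => k i i0 ki i1; nra.
  rewrite ler_pdivlMr//.
  have h : A / y * 3 <= n%:R by near: n; apply: nbhs_infty_ger; exact: num_real.
  by rewrite (le_trans h)// ler_nat.
have bnd n y : 0 < y -> `|mckay_kernel m (c n ^+ 2 / (c n ^+ 2 - 1)) y| <=
    2 `^ (m + 1 / 2) * M * gamma_kernel (m + 1 / 2) (1 / 2) y.
  move=> y0; rewrite mckay_kernel_besselL//.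
  have g0 := ltW (gamma_kernel_gt0 (m + 1 / 2) (c n / (c n + 1)) y0).
  have L0 : 0 <= besselL m (c n / (c n ^+ 2 - 1) * y) by exact: besselL_ge0.
  rewrite ger0_norm; last first.
    by apply: mulr_ge0 => //; apply: mulr_ge0 => //; exact: powR_ge0.
  rewrite mulrAC.
  apply: ler_pM => //.
  - by apply: mulr_ge0 => //; exact: powR_ge0.
  - apply: ler_pM => //; first exact: powR_ge0.
      by apply: (ge0_ler_powR (ltW r0)) (c2 n); rewrite nnegrE// ltW.
    by apply: LM; apply: mulr_gt0.
  - rewrite /gamma_kernel; apply: ler_wpM2l; first exact: powR_ge0.
    rewrite ler_expR lerN2; apply: ler_wpM2r; first exact: ltW.
    rewrite ler_pdivlMr ?addr_gt0//; have := c1 n; lra.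
have [||| hc ht] := @cumul_dominated R
  (fun n => mckay_kernel m (c n ^+ 2 / (c n ^+ 2 - 1)))
  (fun y => l * gamma_kernel (m + 1 / 2) (1 / 2) y) _ _ gi _ _ bnd.
- by move=> n y y0; exact: mckay_kernel_continuous.
- by move=> y y0; apply: cvgM; [exact: cvg_cst|exact: gamma_kernel_continuous].
- move=> y y0.
  have -> : (fun n => mckay_kernel m (c n ^+ 2 / (c n ^+ 2 - 1)) y) =
    (fun n => c n `^ (m + 1 / 2) * (y `^ (m + 1 / 2 - 1) * expR (- (c n / (c n + 1) * y)))
      * besselL m (c n / (c n ^+ 2 - 1) * y)).
    by apply/funext => n; rewrite mckay_kernel_besselL.
  rewrite [X in _ --> X]mulrC; apply: cvgM; last first.
    have /cvg_pinftyP/(_ _ (scvg y y0)) := Ll; exact.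
  have -> : gamma_kernel (m + 1 / 2) (1 / 2) y =
      1 `^ (m + 1 / 2) * gamma_kernel (m + 1 / 2) (1 / (1 + 1)) y.
    by rewrite powR1 [RHS]mul1r.
  apply: cvgM.
    have h := is_derive_continuous (is_derive_powR (m + 1 / 2) (@ltr01 R)).
    exact: (cvg_comp _ _ ccvg h).
  apply: cvgM; first exact: cvg_cst.
  apply: continuous_cvg; first exact: continuous_expR.
  apply: cvgN; apply: cvgM; last exact: cvg_cst.
  apply: cvgM => //; apply: cvgV; first by rewrite gt_eqF.
  by apply: cvgD => //; exact: cvg_cst.
have E0 x : l * cumul (gamma_kernel (m + 1 / 2) (1 / 2)) x =
    cumul (fun y => l * gamma_kernel (m + 1 / 2) (1 / 2) y) x.
  by rewrite /cumul RintegralZl//; exact: cumul_integrable.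
split; first by move=> x; rewrite E0; exact: hc.
by rewrite /total -RintegralZl//; exact: gi.2.
Unshelve. all: by end_near. Qed.

End mckay_limits.

(** * Comparison of the distribution functions *)

Section halfline_cdf.
Context {R : realType}.
Implicit Types (f : R -> R) (x c : R).

Definition halfline_cdf f x : R := cumul f x / total f.

Lemma halfline_integrable_scale f c : halfline_integrable f ->
  (forall y, 0 < y -> 0 < f y) -> 0 < c ->
  halfline_integrable (fun y => f (y / c)).
Proof.
move=> hf f0 c0.
have yc y : is_derive y (1 : R) (fun y => y / c) c^-1.
  apply: (is_derive_eq (is_derive_mul (is_derive_id_pt y) (is_derive_cst_pt c^-1 y))).
  by rewrite mulr0 addr0 mul1r.
apply: (@bounded_primitive_integrable _ _ (fun y => c * cumul f (y / c)) (c * total f)).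
- move=> x x0; have xc0 : 0 < x / c by rewrite divr_gt0.
  have h1 := is_derive_continuous (yc x).
  exact: (cvg_comp _ _ h1 (hf.1 _ xc0)).
- by move=> x x0; apply/ltW/f0; rewrite divr_gt0.
- move=> x x0; have xc0 : 0 < x / c by rewrite divr_gt0.
  have h := is_derive_comp (g := fun y => y / c) (is_derive_cumul hf xc0) (yc x).
  apply: (is_derive_eq (is_derive_scale c h)).
  by rewrite mulrCA divff ?mulr1// gt_eqF.
- move=> x x0; have xc0 : 0 < x / c by rewrite divr_gt0.
  have C0 := ltW (cumul_gt0 hf f0 xc0).
  rewrite ger0_norm; last by rewrite mulr_ge0// ltW.
  rewrite ler_pM2l//; apply: cumul_le_total => // y /f0; exact: ltW.
Qed.

Lemma halfline_cdf_continuous f x : halfline_integrable f -> 0 < x ->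
  {for x, continuous (halfline_cdf f)}.
Proof.
move=> hf x0; apply: (is_derive_continuous (f := halfline_cdf f)).
exact: (is_derive_mul (is_derive_cumul hf x0) (is_derive_cst_pt _ x)).
Qed.

Lemma halfline_cdf_le f x y : halfline_integrable f ->
  (forall y, 0 < y -> 0 < f y) -> 0 < x -> x <= y ->
  halfline_cdf f x <= halfline_cdf f y.
Proof.
move=> hf f0 x0 xy; rewrite ler_pM2r ?invr_gt0 ?total_gt0//.
apply: (derive_ge0_le xy) => z /andP[/(lt_le_trans x0) z0 _].
  exact: is_derive_cumul.
exact/ltW/f0.
Qed.

End halfline_cdf.

(** Near 1, [k^2 / (k^2 - 1)] exceeds [s] as soon as [k < 1 + 1 / (3 s)],
    because [k^2 - 1 <= 3 (k - 1)] for [k <= 2]. *)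
Lemma mul_sqr_sub1_lt (R : realFieldType) (k s i : R) : 1 < k -> k <= 2 ->
  k < 1 + i -> s * i = 1 / 3 -> 0 < s -> 0 < i -> s * (k ^+ 2 - 1) < k ^+ 2.
Proof.
move=> k1 k2 ki si s0 i0; have h : (k - 1) * (k + 1) <= i * 3.
  by apply: ler_pM; rewrite ?subr_ge0; lra.
have : s * ((k - 1) * (k + 1)) <= s * (i * 3) by rewrite ler_pM2l.
have -> : s * (i * 3) = 1 by rewrite mulrA si; field.
nra.
Qed.

Section mckay_vs_gamma.
Context {R : realType} (m N : R).
Context (m2 : - (1 / 2) < m).
Context (totalN : forall t, 1 < t -> total (mckay_kernel m t) = N).
Implicit Types (t x : R).

Let a0 : 0 < 2 * m + 1. Proof. have := m2; lra. Qed.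
Let r0 : 0 < m + 1 / 2. Proof. have := m2; lra. Qed.
Let half0 : 0 < 1 / 2 :> R. Proof. by rewrite divr_gt0. Qed.

Let N0 : 0 < N.
Proof.
have t2 : 1 < 2 :> R by rewrite ltr1n.
rewrite -(totalN t2); apply: total_gt0; first exact: mckay_kernel_integrable (ltW t2).
by move=> y; exact: mckay_kernel_gt0 (ltW t2).
Qed.

Lemma halfline_cdf_mckay_lt t t' x : 1 < t -> t < t' -> 0 < x -> x <= 2 * m + 1 ->
  halfline_cdf (mckay_kernel m t) x < halfline_cdf (mckay_kernel m t') x.
Proof.
move=> t1 tt' x0 xa; rewrite /halfline_cdf !totalN//; last exact: lt_trans tt'.
by rewrite ltr_pM2r ?invr_gt0//; exact: cumul_mckay_lt.
Qed.

(** The common mass [N] passes to the limit [t -> 1], which normalises the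
    limit kernel. Strictness survives because the limit is compared with the
    intermediate parameter [(1 + t) / 2]. *)
Lemma gamma_lt_mckay t x : 1 < t -> 0 < x -> x <= 2 * m + 1 ->
  halfline_cdf (gamma_kernel (2 * m + 1) 1) x < halfline_cdf (mckay_kernel m t) x.
Proof.
move=> t1 x0 xa; have [cx ct] := mckay_kernel_cvg1 m2.
have gi := gamma_kernel_integrable a0 (@ltr01 R).
have g0 : 0 < total (gamma_kernel (2 * m + 1) 1 : R -> R).
  by apply: total_gt0 => // y; exact: gamma_kernel_gt0.
have B0 : 0 < besselB m 0 by exact: besselB_gt0.
have NE : N = besselB m 0 * total (gamma_kernel (2 * m + 1) 1).
  apply: (cvg_unique _ _ ct) => //; apply: cvg_near_cst; apply: nearW => n.
  by rewrite totalN//; have [] := @harmonicS_bounds R n.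
pose t' := (1 + t) / 2.
have t'1 : 1 < t' by rewrite ltr_pdivlMr//; lra.
have t't : t' < t by rewrite ltr_pdivrMr//; lra.
have h : besselB m 0 * cumul (gamma_kernel (2 * m + 1) 1) x <= cumul (mckay_kernel m t') x.
  apply: (cvgr_to_le (cx x)); near=> n; apply/ltW/cumul_mckay_lt => //.
    by have [] := @harmonicS_bounds R n.
  by near: n; move/cvgr_lt : (@cvg_harmonicS R); apply.
have {}h := le_lt_trans h (cumul_mckay_lt m2 t'1 t't x0 xa).
rewrite /halfline_cdf totalN// NE ltr_pdivlMr ?mulr_gt0//.
rewrite [ltLHS](_ : _ = besselB m 0 * cumul (gamma_kernel (2 * m + 1) 1) x)//.
move: (besselB _ _) (cumul _ _) (total _) g0 => B J T T0.
by field; rewrite gt_eqF.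
Unshelve. all: by end_near. Qed.

(** Same argument at [t -> oo], through the intermediate parameter
    [t + 1]. *)
Lemma mckay_lt_gamma t x : 1 < t -> 0 < x -> x <= 2 * m + 1 ->
  halfline_cdf (mckay_kernel m t) x < halfline_cdf (gamma_kernel (m + 1 / 2) (1 / 2)) x.
Proof.
move=> t1 x0 xa; have [l l0 [cx ct]] := mckay_kernel_cvgy m2.
have gi := gamma_kernel_integrable r0 half0.
set g := gamma_kernel (m + 1 / 2) (1 / 2) in cx ct gi *.
have g0 : 0 < total g.
  by apply: total_gt0 => // y; exact: gamma_kernel_gt0.
pose c n : R := 1 + n.+1%:R^-1.
have c1 n : 1 < c n by have [] := @harmonicS_bounds R n.
have cc0 n : 0 < c n ^+ 2 - 1.
  by rewrite subr_gt0 -[ltLHS](expr1n R 2) ltrXn2r// nnegrE ltW// (lt_trans ltr01).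
have th1 n : 1 < c n ^+ 2 / (c n ^+ 2 - 1) by rewrite ltr_pdivlMr// mul1r gtrBl.
have NE : N = l * total g.
  apply: (cvg_unique _ _ ct) => //; apply: cvg_near_cst; apply: nearW => n.
  by rewrite totalN//; exact: th1.
have lg0 : 0 < l.
  by move: N0; rewrite NE pmulr_lgt0.
pose t' := t + 1.
have t't : t < t' by rewrite ltrDl.
have tp : 0 < t' := lt_trans (lt_trans ltr01 t1) t't.
have h : cumul (mckay_kernel m t') x <= l * cumul g x.
  apply: (cvgr_to_ge (cx x)); near=> n; apply/ltW/cumul_mckay_lt => //.
    exact: lt_trans t't.
  rewrite -/(c n) ltr_pdivlMr//.
  have cn : c n < 1 + (3 * t')^-1.
    near: n; move/cvgr_lt : (@cvg_harmonicS R); apply.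
    by rewrite ltrDl invr_gt0 mulr_gt0.
  have c2 : c n <= 2 by have [] := @harmonicS_bounds R n.
  have c1n := c1 n.
  have ti : t' * (3 * t')^-1 = 1 / 3 by field; rewrite gt_eqF.
  have ti0 : 0 < (3 * t')^-1 by rewrite invr_gt0 mulr_gt0.
  exact: mul_sqr_sub1_lt c1n c2 cn ti tp ti0.
have {}h := lt_le_trans (cumul_mckay_lt m2 t1 t't x0 xa) h.
rewrite /halfline_cdf totalN// NE ltr_pdivrMr ?mulr_gt0//.
rewrite [ltRHS](_ : _ = l * cumul g x)//.
move: (cumul _ _) (total _) g0 => J T T0.
by field; rewrite gt_eqF.
Unshelve. all: by end_near. Qed.

End mckay_vs_gamma.

(** * Medians of laws on the half-line *)

Section median.
Context {R : realType}.
Implicit Types (f F : R -> R) (x y K phi : R).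
Notation mu := (@lebesgue_measure R).

Lemma halfline_integral K phi f (A B : set R) : measurable A -> measurable B ->
  A `&` `]0, +oo[ = B -> mu.-integrable B (EFin \o (fun y => f (y / phi))) ->
  (\int[mu]_(x in A) (((fun y => K * f (y / phi)) \_ `]0, +oo[) x)%:E
    = (K * \int[mu]_(y in B) f (y / phi))%:E)%E.
Proof.
move=> mA mB AB iB.
have iKB : mu.-integrable B (fun y => (K * f (y / phi))%:E).
  exact: (@integrableZl _ _ _ mu _ _ K (EFin \o (fun y => f (y / phi)))).
rewrite -RintegralZl// /Rintegral fineK; last exact: integrable_fin_num.
rewrite -AB integral_mkcondr; apply: eq_integral => x _.
by rewrite !patchE; case: ifP.
Qed.

Context d (T : measurableType d) (P : probability T R) (X : {RV P >-> R}).

(** Only the values of [F] on the half-line are constrained; [cdf X 0 = 0]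
    makes the median positive, hence places it where [F] is continuous. *)
Definition halfline_law F : Prop :=
  [/\ forall x, 0 < x -> cdf X x = (F x)%:E,
      forall x, 0 < x -> {for x, continuous F} & cdf X 0 = 0%E].

(** The total mass 1 of the law determines the constant [K], which therefore
    disappears from the distribution function. *)
Lemma density_halfline_law K phi f : 0 < phi -> halfline_integrable f ->
  (forall y, 0 < y -> 0 < f y) ->
  has_density X ((fun y => K * f (y / phi)) \_ `]0, +oo[) ->
  K * phi * total f = 1 /\ halfline_law (fun x => halfline_cdf f (x / phi)).
Proof.
move=> phi0 hf f0 hX; have hfc := halfline_integrable_scale hf f0 phi0.
have t0 := total_gt0 hf f0.
have Kt : K * phi * total f = 1.
  have := hX setT measurableT;
    rewrite (@halfline_integral K phi f _ [set` `]0, +oo[])//.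
  - rewrite -/(total (fun y => f (y / phi))) total_scale// mulrA.
    by rewrite probability_setT => -[].
  - by rewrite setTI.
  - exact: hfc.2.
split=> //; split=> [x x0|x x0|].
- have := hX [set` `]-oo, x]] (measurable_itv _).
  rewrite (@halfline_integral K phi f _ [set` `]0, x]])//.
  + rewrite -/(cumul (fun y => f (y / phi)) x) cumul_scale// mulrA => hd.
    rewrite /cdf [LHS]hd.
    congr (_%:E); rewrite /halfline_cdf; apply: (mulIf (lt0r_neq0 t0)).
    by rewrite divfK ?lt0r_neq0// mulrAC Kt mul1r.
  + rewrite predeqE => y; split => /=; rewrite !in_itv /= ?andbT.
      by move=> [-> ->].
    by move=> /andP[-> ->].
  + exact: cumul_integrable.
- have xp0 : 0 < x / phi by rewrite divr_gt0.
  have h1 : is_derive x (1 : R) (fun y => y / phi) _ :=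
    is_derive_mul (is_derive_id_pt x) (is_derive_cst_pt phi^-1 x).
  exact: (cvg_comp _ _ (is_derive_continuous h1) (halfline_cdf_continuous hf xp0)).
- have := hX [set` `]-oo, 0]] (measurable_itv _).
  rewrite (@halfline_integral K phi f _ set0)//.
  + by rewrite Rintegral_set0 mulr0.
  + rewrite predeqE => y; split => //=; rewrite !in_itv /= ?andbT.
    by move=> [y0 /(le_lt_trans y0)]; rewrite ltxx.
  + exact: integrable_set0.
Qed.

Let S := [set x : R | ((1 / 2)%:E <= cdf X x)%E].

Let half_gt0 : (0 < (1 / 2 : R)%:E)%E. Proof. by rewrite lte_fin divr_gt0. Qed.

Context (F : R -> R) (lawF : halfline_law F).

Let S_gt0 x : S x -> 0 < x.
Proof.
move=> Sx; rewrite ltNge; apply/negP => x0.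
have [_ _ c0] := lawF.
have := cdf_nondecreasing X x0; rewrite c0 => h.
by have := lt_le_trans half_gt0 (le_trans Sx h); rewrite ltxx.
Qed.

Let S_lb : has_lbound S.
Proof. by exists 0 => x /S_gt0/ltW. Qed.

Let cdf_fin x : cdf X x \is a fin_num.
Proof. by rewrite ge0_fin_numE ?cdf_ge0// (le_lt_trans (cdf_le1 X x))// ltry. Qed.

Let S_neq0 : S !=set0.
Proof.
have /fine_cvg cy : cdf X @ +oo%R --> 1%:E by exact: cvg_cdfy1.
near (+oo : set_system R) => x.
exists x; rewrite /S /= -(fineK (cdf_fin x)) lee_fin ltW//; near: x.
by move/cvgr_gt : cy; apply; rewrite ltr_pdivrMr// mul1r ltr1n.
Unshelve. all: by end_near. Qed.

(** By right continuity the distribution function is still below one half a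
    little to the right of [x]. *)
Lemma lt_Med x : (cdf X x < (1 / 2)%:E)%E -> x < Med X.
Proof.
rewrite -(fineK (cdf_fin x)) lte_fin => cx.
have rc := @cdf_right_continuous _ _ _ P X x.
rewrite -[X in _ --> X](fineK (cdf_fin x)) in rc.
have {}rc : fine (cdf X y) @[y --> x^'+] --> fine (cdf X x) by exact: fine_cvg.
near x^'+ => y.
have xy : x < y by near: y; exact: nbhs_right_gt.
have cy : (cdf X y < (1 / 2)%:E)%E.
  rewrite -(fineK (cdf_fin y)) lte_fin; near: y.
  by move/cvgr_lt : rc; apply.
apply: (lt_le_trans xy); apply: lb_le_inf; first exact: S_neq0.
move=> z Sz; rewrite leNgt; apply/negP => /ltW/(cdf_nondecreasing X) h'.
by have := le_lt_trans (le_trans Sz h') cy; rewrite ltxx.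
Unshelve. all: by end_near. Qed.

Lemma Med_le x : 0 < x -> 1 / 2 <= F x -> Med X <= x.
Proof.
move=> x0 Fx; apply: ge_inf; first exact: S_lb.
have [cF _ _] := lawF.
by rewrite /S /= cF// lee_fin.
Qed.

(** By continuity [F] is still above one half a little to the left of [x]. *)
Lemma Med_lt x : 0 < x -> 1 / 2 < F x -> Med X < x.
Proof.
move=> x0 Fx; have [_ ctF _] := lawF.
have h : \forall y \near x^'-, 0 < y /\ 1 / 2 <= F y.
  near=> y; split; first by near: y; exact: nbhs_left_gt.
  apply/ltW; near: y; apply: (cvgr_gt (F x)) => //.
  exact: cvg_at_left_filter (ctF _ x0).
near x^'- => y.
have [y0 Fy] : 0 < y /\ 1 / 2 <= F y by near: y.
apply: le_lt_trans (Med_le y0 Fy) _.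
by near: y; exact: nbhs_left_lt.
Unshelve. all: by end_near. Qed.

Lemma Med_gt0 : 0 < Med X.
Proof. by apply: lt_Med; have [_ _ ->] := lawF. Qed.

Lemma cdf_Med : F (Med X) = 1 / 2.
Proof.
have M0 := Med_gt0; have [cF _ _] := lawF.
apply/eqP; rewrite eq_le; apply/andP; split; rewrite leNgt; apply/negP => h.
  by have := Med_lt M0 h; rewrite ltxx.
have := @lt_Med (Med X); rewrite cF// lte_fin => /(_ h).
by rewrite ltxx.
Qed.

End median.

(** Since [Med X <= A], the comparison applies at [Med X], where [F] is one
    half and [G] is therefore larger. *)
Lemma Med_lt_of_cdf_lt {R : realType} d1 d2 (T1 : measurableType d1)
  (T2 : measurableType d2) (P1 : probability T1 R) (P2 : probability T2 R)
  (X : {RV P1 >-> R}) (Y : {RV P2 >-> R}) (F G : R -> R) (A : R) :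
  halfline_law X F -> halfline_law Y G -> 0 < A -> 1 / 2 <= F A ->
  (forall x, 0 < x -> x <= A -> F x < G x) -> Med Y < Med X.
Proof.
move=> lF lG A0 FA FG; have M0 := Med_gt0 lF.
apply: (Med_lt lG M0); rewrite -(cdf_Med lF); apply: FG => //.
exact: Med_le lF _ _ _.
Qed.

Lemma halfline_cdf_le_half (R : realType) (f : R -> R) x : 0 < total f ->
  (halfline_cdf f x <= 1 / 2) = (cumul f x <= total f / 2).
Proof. by move=> t0; rewrite ler_pdivrMr// mulrC mulrA mulr1. Qed.

Lemma half_le_halfline_cdf (R : realType) (f : R -> R) x : 0 < total f ->
  (1 / 2 <= halfline_cdf f x) = (total f / 2 <= cumul f x).
Proof. by move=> t0; rewrite ler_pdivlMr// mulrC mulrA mulr1. Qed.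

(** * Numerical bounds *)

Section elementary.
Context {R : realType}.
Implicit Types (a u x : R).

Lemma expRN_lt_quadratic u : 0 < u -> expR (- u) < 1 - u + u ^+ 2 / 2.
Proof.
move=> u0; rewrite -subr_gt0.
have dE x : is_derive x (1 : R) (fun u => 1 - u + u ^+ 2 / 2 - expR (- u))
    (x - 1 + expR (- x)).
  have d1 := is_derive_id_pt x; have d2 := is_derive_exp (is_derive_opp d1).
  have d3 := is_derive_mul (is_derive_sqr d1) (is_derive_cst_pt (2^-1) x).
  have d4 := is_derive_sub (is_derive_cst_pt 1 x) d1.
  by apply: (is_derive_eq (is_derive_sub (is_derive_add d4 d3) d2)); field.
rewrite [ltLHS](_ : _ = 1 - 0 + 0 ^+ 2 / 2 - expR (- 0)); last first.
  by rewrite oppr0 expR0; field.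
apply: (derive_gt0_lt (f := fun u => 1 - u + u ^+ 2 / 2 - expR (- u)) u0
  (fun y _ => dE y)) => y /andP[y0 _].
have : - y != 0 by rewrite oppr_eq0 gt_eqF.
move=> /expR_gt1Dx; lra.
Qed.

Lemma expR_ge_cubic x : 0 <= x -> 1 + x + x ^+ 2 / 2 + x ^+ 3 / 6 <= expR x.
Proof.
move=> x0; rewrite -subr_ge0.
apply: (derive_ge0_ge0 (f := fun x => expR x - (1 + x + x ^+ 2 / 2 + x ^+ 3 / 6))
  (df := fun x => expR x - (1 + x + x ^+ 2 / 2)) x0).
- by rewrite expR0; field.
- move=> y; have d1 := is_derive_id_pt y; have d2 := is_derive_sqr d1.
  have -> : (fun x : R => expR x - (1 + x + x ^+ 2 / 2 + x ^+ 3 / 6)) =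
      (fun x => expR x - (1 + x + 2^-1 * x ^+ 2 + 6^-1 * (x * x ^+ 2))).
    by apply/funext => z; field.
  have d3 := is_derive_add (is_derive_add (is_derive_cst_pt 1 y) d1)
    (is_derive_scale 2^-1 d2).
  have d4 := is_derive_add d3 (is_derive_scale 6^-1 (is_derive_mul d1 d2)).
  by apply: (is_derive_eq (is_derive_sub (is_derive_exp d1) d4)); field.
move=> y y0; apply: (derive_ge0_ge0 (f := fun x => expR x - (1 + x + x ^+ 2 / 2))
  (df := fun x => expR x - (1 + x)) y0).
- by rewrite expR0; field.
- move=> z; have d1 := is_derive_id_pt z.
  have d2 := is_derive_mul (is_derive_sqr d1) (is_derive_cst_pt (2^-1) z).
  have d3 := is_derive_add (is_derive_add (is_derive_cst_pt 1 z) d1) d2.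
  by apply: (is_derive_eq (is_derive_sub (is_derive_exp d1) d3)); field.
- by move=> z _; rewrite subr_ge0 expR_ge1Dx.
Qed.

(** Four terms of [ln ((1 + x) / (1 - x)) = 2 (x + x^3/3 + x^5/5 + ...)] at
    [x = 1/3]; the remainder has the derivative [2 x^8 / (1 - x^2)]. *)
Lemma ln2_ge : 2 * (1 / 3 + 1 / 81 + 1 / 1215 + 1 / 15309) <= ln 2 :> R.
Proof.
pose f (x : R) := ln (1 + x) - ln (1 - x)
  - 2 * (x + 3^-1 * (x * x ^+ 2) + 5^-1 * (x * (x ^+ 2) ^+ 2) + 7^-1 * (x * x ^+
      2 * (x ^+ 2) ^+ 2)).
pose df (x : R) := 2 * x ^+ 8 / (1 - x ^+ 2).
have dE x : 0 <= x <= 1 / 3 -> is_derive x (1 : R) f (df x).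
  move=> /andP[x0 x3]; have p0 : 0 < 1 + x by lra.
  have q0 : 0 < 1 - x by lra.
  have d1 := is_derive_id_pt x; have d2 := is_derive_sqr d1.
  have d4 := is_derive_sqr d2.
  have c1 := is_derive_cst_pt (1 : R) x.
  have l1 := is_derive_comp (g := fun x => 1 + x) (is_derive1_ln p0) (is_derive_add c1 d1).
  have l2 := is_derive_comp (g := fun x => 1 - x) (is_derive1_ln q0) (is_derive_sub c1 d1).
  have s3 := is_derive_add d1 (is_derive_scale 3^-1 (is_derive_mul d1 d2)).
  have s5 := is_derive_add s3 (is_derive_scale 5^-1 (is_derive_mul d1 d4)).
  have s7 := is_derive_add s5 (is_derive_scale 7^-1 (is_derive_mul
    (is_derive_mul d1 d2) d4)).
  apply: (is_derive_eq (is_derive_sub (is_derive_sub l1 l2) (is_derive_scale 2 s7))).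
  have n0 : 1 - x ^+ 2 != 0 by rewrite gt_eqF//; nra.
  rewrite /df; field; rewrite n0 !gt_eqF//; lra.
have : f 0 <= f (1 / 3).
  apply: (derive_ge0_le _ dE); first by rewrite divr_ge0.
  move=> x /andP[x0 x3]; apply: divr_ge0; last nra.
  by rewrite mulr_ge0// exprn_ge0.
have -> : f 0 = 0 by rewrite /f addr0 subr0 ln1; ring.
rewrite /f.
have -> : ln (1 + 1 / 3) - ln (1 - 1 / 3) = ln 2 :> R.
  rewrite -ln_div ?posrE; [by congr (ln _); field|lra|lra].
lra.
Qed.

(** The defect [a - a exp (- 1 / (3 a))] is nondecreasing in [a], so [a = 2] is
    the critical case: it reads [2 exp (- 1/6) <= 1 + ln 2]. *)
Lemma mul_expRN_le_ln2 a : 2 <= a -> a * expR (- (1 / (3 * a))) <= a - 1 + ln 2.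
Proof.
move=> a2; pose f x := x - x * expR (- (1 / (3 * x))).
have : f 2 <= f a.
  apply: (derive_ge0_le (df := fun x => 1 - expR (- (1 / (3 * x))) * (1 + 1 / (3 * x))) a2).
    move=> x /andP[x2 _]; have x0 : 0 < x by lra.
    have d1 := is_derive_id_pt x.
    have n3 : 3 * x != 0 by rewrite mulf_neq0// gt_eqF.
    have d2 := is_derive_scale 1 (is_derive_inv (f := fun x => 3 * x) n3
      (is_derive_scale 3 d1)).
    apply: (is_derive_eq (is_derive_sub d1 (is_derive_mul d1 (is_derive_exp
      (is_derive_opp d2))))).
    by field; rewrite gt_eqF.
  move=> x /andP[x2 _];
    rewrite subr_ge0 expRN [leLHS]mulrC ler_pdivrMr ?expR_gt0// [leRHS]mul1r.
  exact: expR_ge1Dx.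
(* 1531 / 1296 is the cubic Taylor polynomial of exp at 1/6 *)
have e6 : expR (- (1 / (3 * 2))) <= 1296 / 1531 :> R.
  have -> : 1 / (3 * 2) = 1 / 6 :> R by field.
  have x0 : 0 <= 1 / 6 :> R by rewrite divr_ge0.
  have := expR_ge_cubic x0; rewrite expRN => h.
  rewrite -[leLHS]mul1r ler_pdivrMr; first lra.
  exact: expR_gt0.
have := ln2_ge; rewrite /f; lra.
Qed.

End elementary.

(** * Densities in a common form *)

Lemma gamma_pdfE (R : realType) (r l phi : R) : 0 < phi ->
  gamma_pdf r l = (fun x => l `^ r / Gamma r * phi `^ (r - 1) *
    gamma_kernel r (l * phi) (x / phi)) \_ `]0, +oo[.
Proof.
move=> phi0; apply/funext => x; rewrite /gamma_pdf !patchE; case: ifPn => //.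
rewrite inE /= in_itv /= andbT => x0; have xp : 0 < x / phi by rewrite divr_gt0.
rewrite /gamma_kernel.
have -> : l * phi * (x / phi) = l * x by field; rewrite gt_eqF.
have -> : x `^ (r - 1) = phi `^ (r - 1) * (x / phi) `^ (r - 1).
  by rewrite -powRM ?ltW// mulrC divfK// gt_eqF.
move: (Gamma r) (l `^ r) => g p; ring.
Qed.

(** With [s = c / (c^2 - 1)] the scale is [b = phi / s], so the Bessel function
    is taken at [s y] and [c x / b = t y] for [y = x / phi]. All powers of
    [c^2 - 1] and of [s] then combine into the power [t^r] inside the kernel,
    and the constant in front no longer depends on [c]. *)
Lemma mckay1_pdfE (R : realType) (m phi c : R) : - (1 / 2) < m -> 0 < phi -> 1 < c ->
  mckay1_pdf m c (phi * (c ^+ 2 - 1) / c) =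
  (fun x => Num.sqrt pi / (2 `^ m * 2 `^ m * phi * Gamma (m + 1 / 2)) *
    mckay_kernel m (c ^+ 2 / (c ^+ 2 - 1)) (x / phi)) \_ `]0, +oo[.
Proof.
move=> m2 phi0 c1; apply/funext => x; rewrite /mckay1_pdf !patchE; case: ifPn => //.
rewrite inE /= in_itv /= andbT => x0.
have c0 : 0 < c by rewrite (lt_trans _ c1).
have cc0 : 0 < c ^+ 2 - 1 by rewrite subr_gt0 -[ltLHS](expr1n R 2) ltrXn2r// nnegrE ltW.
have r0 : 0 < m + 1 / 2 by lra.
pose s := c / (c ^+ 2 - 1); have s0 : 0 < s by rewrite divr_gt0.
pose b := phi * (c ^+ 2 - 1) / c; have b0 : 0 < b by rewrite divr_gt0// mulr_gt0.
rewrite -/b; pose y := x / phi; have y0 : 0 < y by rewrite divr_gt0.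
rewrite -/y.
have ccn : c ^+ 2 - 1 != 0 by rewrite gt_eqF.
have cn : c != 0 by rewrite gt_eqF.
have pn : phi != 0 by rewrite gt_eqF.
have xb : x / b = s * y by rewrite /b /s /y; field; rewrite ccn cn pn.
have bs : b * s = phi by rewrite /b /s; field; rewrite ccn cn.
have cs : (c ^+ 2 - 1) * s = c by rewrite /s; field.
have th : c ^+ 2 / (c ^+ 2 - 1) = c * s by rewrite /s; field.
rewrite xb besselIE//; last exact: mulr_gt0.
rewrite /mckay_kernel /gamma_kernel.
have -> : y ^+ 2 * ((c ^+ 2 / (c ^+ 2 - 1)) ^+ 2 - c ^+ 2 / (c ^+ 2 - 1)) / 4 =
  (s * y) ^+ 2 / 4.
  by rewrite /s; field.
have -> : c * x / b = c ^+ 2 / (c ^+ 2 - 1) * y by rewrite th -mulrA xb mulrA.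
have xE : x = phi * y by rewrite /y mulrC divfK.
rewrite {1}xE.
have P1 : (s * y / 2) `^ m * 2 `^ m = s `^ m * y `^ m.
  rewrite -powRM ?ltW//; last by rewrite divr_gt0// mulr_gt0.
  by rewrite divfK// powRM// ltW.
have P2 : b `^ (m + 1) * (s * s `^ m) = phi * phi `^ m.
  by rewrite -!powR_addr1// -powRM ?ltW// bs.
have P3 : (c ^+ 2 - 1) `^ (m + 1 / 2) * s `^ (m + 1 / 2) = c `^ (m + 1 / 2).
  by rewrite -powRM ?ltW// cs.
have P4 : s * s `^ m * s `^ m = s `^ (m + 1 / 2) * s `^ (m + 1 / 2).
  rewrite -powR_addr1// -!powRD ?(gt_eqF s0) ?implybT//; congr (_ `^ _); by field.
have P5 : (c ^+ 2 / (c ^+ 2 - 1)) `^ (m + 1 / 2) = c `^ (m + 1 / 2) * s `^ (m + 1 / 2).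
  by rewrite th powRM// ltW.
have P6 : y `^ (2 * m + 1 - 1) = y `^ m * y `^ m.
  rewrite -powRD ?(gt_eqF y0) ?implybT//; congr (_ `^ _); by ring.
rewrite P5 P6 (powRM _ (ltW phi0) (ltW y0)).
have q1 : 0 < 2 `^ m :> R by exact: powR_gt0.
have q2 : 0 < s `^ m by exact: powR_gt0.
have q3 : 0 < b `^ (m + 1) by exact: powR_gt0.
have q4 : 0 < s `^ (m + 1 / 2) by exact: powR_gt0.
have q5 : 0 < phi `^ m by exact: powR_gt0.
have g0 : 0 < Gamma (m + 1 / 2) by exact: Gamma_gt0.
move: P1 P2 P3 P4 q1 q2 q3 q4 q5 g0; clear -pn s0.
move: (besselB _ _) (expR _) (Num.sqrt pi) (y `^ m) (Gamma _) => B E w Y g.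
move: (phi `^ m) (b `^ _) (2 `^ m) ((c ^+ 2 - 1) `^ _) (c `^ _) (s `^ (m + 1 /
  2)) (s `^ m) ((s * y / 2) `^ m).
move=> F b1 t C Cr S sm D P1 P2 P3 P4 t0 sm0 b10 S0 F0 g0.
have -> : D = sm * Y / t by rewrite -P1 mulfK// gt_eqF.
rewrite -P3.
have -> : b1 = phi * F / (s * sm).
  by rewrite -P2 mulfK// mulf_neq0// gt_eqF.
transitivity (w * C * (s * sm * sm) * Y * Y * E * B / (t * t * phi * g)).
  by field; rewrite ?pn ?gt_eqF.
rewrite P4; by field; rewrite ?pn ?gt_eqF.
Qed.

(** * Monotonicity and bounds of the McKay median *)

Theorem corollary2p4 (R : realType) (m phi : R)
  (hm : - (1 / 2) < m) (hphi : 0 < phi)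
  (d : R -> measure_display) (T : forall c : R, measurableType (d c))
  (P : forall c : R, probability (T c) R)
  (Z : forall c : R, {RV (P c) >-> R})
  (hZ : forall c : R, 1 < c ->
     has_density (Z c) (mckay1_pdf m c (phi * (c ^+ 2 - 1) / c))) :
  (forall c1 c2 : R, 1 < c1 -> c1 < c2 -> Med (Z c1) < Med (Z c2))
  /\
  (forall (d1 d2 : measure_display)
     (T1 : measurableType d1) (T2 : measurableType d2)
     (P1 : probability T1 R) (P2 : probability T2 R)
     (G1 : {RV P1 >-> R}) (G2 : {RV P2 >-> R}),
     has_density G1 (gamma_pdf (m + 1 / 2) (2 * phi)^-1) ->
     has_density G2 (gamma_pdf (2 * m + 1) (1 / phi)) ->
     forall c : R, 1 < c -> Med G1 < Med (Z c) /\ Med (Z c) < Med G2)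
  /\
  (forall c : R, 1 < c ->
     (2 * m + 1 - 2 * ln 2) * phi
       < (2 * m + 1) * phi * expR (- (2 * ln 2) / (2 * m + 1))
     /\ (2 * m + 1) * phi * expR (- (2 * ln 2) / (2 * m + 1)) < Med (Z c))
  /\
  (forall c : R, 1 < c ->
     Med (Z c) < (2 * m + 1) * phi * expR (- (1 / (3 * (2 * m + 1))))
     /\ (2 * m + 1) * phi * expR (- (1 / (3 * (2 * m + 1))))
          < (2 * m + 2 / 3 + 1 / (18 * (2 * m + 1))) * phi)
  /\
  (1 / 2 <= m -> forall c : R, 1 < c ->
     (2 * m + 1 / 3) * phi < Med (Z c) /\ Med (Z c) <= (2 * m + ln 2) * phi).

Proof.
have a0 : 0 < 2 * m + 1 by lra.
have r0 : 0 < m + 1 / 2 by lra.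
have half0 : 0 < 1 / 2 :> R by rewrite divr_gt0.
have phin : phi != 0 by rewrite gt_eqF.
pose th (c : R) : R := c ^+ 2 / (c ^+ 2 - 1).
have cc0 (c : R) : 1 < c -> 0 < c ^+ 2 - 1.
  by move=> c1; rewrite subr_gt0 -[ltLHS](expr1n R 2) ltrXn2r// nnegrE ltW//
    (lt_trans ltr01).
have th1 (c : R) : 1 < c -> 1 < th c.
  by move=> /cc0 h; rewrite /th ltr_pdivlMr// mul1r gtrBl.
pose K := Num.sqrt pi / (2 `^ m * 2 `^ m * phi * Gamma (m + 1 / 2)).
have lawZ (c : R) : 1 < c -> K * phi * total (mckay_kernel m (th c)) = 1 /\
    halfline_law (Z c) (fun x => halfline_cdf (mckay_kernel m (th c)) (x / phi)).
  move=> c1; have t1 := ltW (th1 c c1).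
  apply: (density_halfline_law hphi (mckay_kernel_integrable hm t1)).
    by move=> y; exact: mckay_kernel_gt0.
  by rewrite -mckay1_pdfE//; exact: hZ.
pose N := (K * phi)^-1.
(* every [t > 1] is [th c] for [c = sqrt (t / (t - 1))] *)
have totalN (t : R) : 1 < t -> total (mckay_kernel m t) = N.
  move=> t1; have t10 : 0 < t - 1 by rewrite subr_gt0.
  pose c := Num.sqrt (t / (t - 1)).
  have c2 : c ^+ 2 = t / (t - 1) by rewrite sqr_sqrtr// divr_ge0 ?ltW// (lt_trans ltr01).
  have c1 : 1 < c.
    rewrite -(@ltr_pXn2r _ 2)// ?nnegrE ?sqrtr_ge0// expr1n c2 ltr_pdivlMr// mul1r.
    by rewrite gtrBl.
  have -> : t = th c.
    by rewrite /th c2; field; rewrite !gt_eqF//; lra.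
  have [Kt _] := lawZ c c1; have KP : K * phi != 0.
    by apply/eqP => h; move: Kt; rewrite h mul0r => /eqP; rewrite eq_sym oner_eq0.
  by apply: (mulfI KP); rewrite Kt /N divff.
have law_Z c c1 := (lawZ c c1).2.
have law_G1 (d1 : measure_display) (T1 : measurableType d1) (P1 : probability T1 R)
    (G1 : {RV P1 >-> R}) : has_density G1 (gamma_pdf (m + 1 / 2) (2 * phi)^-1) ->
  halfline_law G1 (fun x => halfline_cdf (gamma_kernel (m + 1 / 2) (1 / 2)) (x / phi)).
  rewrite (gamma_pdfE _ _ hphi) (_ : (2 * phi)^-1 * phi = 1 / 2); last by field.
  move=> hG; apply: (density_halfline_law hphi _ _ hG).2.
    exact: gamma_kernel_integrable.
  by move=> y; exact: gamma_kernel_gt0.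
have law_G2 (d2 : measure_display) (T2 : measurableType d2) (P2 : probability T2 R)
    (G2 : {RV P2 >-> R}) : has_density G2 (gamma_pdf (2 * m + 1) (1 / phi)) ->
  halfline_law G2 (fun x => halfline_cdf (gamma_kernel (2 * m + 1) 1) (x / phi)).
  rewrite (gamma_pdfE _ _ hphi) (_ : 1 / phi * phi = 1); last by field.
  move=> hG; apply: (density_halfline_law hphi _ _ hG).2.
    exact: gamma_kernel_integrable.
  by move=> y; exact: gamma_kernel_gt0.
have gi1 := gamma_kernel_integrable r0 half0.
have gi2 := gamma_kernel_integrable a0 (@ltr01 R).
have g1t : 0 < total (gamma_kernel (m + 1 / 2) (1 / 2)).
  by apply: total_gt0 => // y; exact: gamma_kernel_gt0.
have g2t : 0 < total (gamma_kernel (2 * m + 1) 1).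
  by apply: total_gt0 => // y; exact: gamma_kernel_gt0.
(* [A], the mean of the gamma law of shape [2 m + 1], lies beyond all the
   medians under comparison *)
pose A := (2 * m + 1) * phi; have A0 : 0 < A by rewrite mulr_gt0.
have Ap (x : R) : 0 < x -> x <= A -> 0 < x / phi /\ x / phi <= 2 * m + 1.
  by move=> x0 xA; split; [rewrite divr_gt0|rewrite ler_pdivrMr].
have AE : A / phi = 2 * m + 1 by rewrite /A mulfK.
pose ub := (2 * m + 1) * expR (- (1 / (3 * (2 * m + 1)))).
have ub0 : 0 < ub by rewrite mulr_gt0 ?expR_gt0.
have uba : ub <= 2 * m + 1.
  rewrite -[leRHS]mulr1 ler_pM2l// -[leRHS](@expR0 R) ler_expR oppr_le0 divr_ge0//.
  by rewrite mulr_ge0// ltW.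
have G2ub : 1 / 2 <= halfline_cdf (gamma_kernel (2 * m + 1) 1) ub.
  rewrite half_le_halfline_cdf//.
  by have := gamma_median_ub a0 (@ltr01 R); rewrite divr1.
have G2A : 1 / 2 <= halfline_cdf (gamma_kernel (2 * m + 1) 1) (2 * m + 1).
  apply: (le_trans G2ub); apply: halfline_cdf_le => // y; exact: gamma_kernel_gt0.
have ZA (c : R) : 1 < c -> 1 / 2 < halfline_cdf (mckay_kernel m (th c)) (A / phi).
  move=> c1; rewrite AE (le_lt_trans G2A)//.
  by apply: (gamma_lt_mckay hm totalN) => //; exact: th1.
have ZG1 (c x : R) : 1 < c -> 0 < x -> x <= A ->
    halfline_cdf (mckay_kernel m (th c)) (x / phi)
    < halfline_cdf (gamma_kernel (m + 1 / 2) (1 / 2)) (x / phi).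
  move=> c1 x0 /(Ap x x0)[xp0 xpa].
  by apply: (mckay_lt_gamma hm totalN) => //; exact: th1.
have ZG2 (c x : R) : 1 < c -> 0 < x -> x <= A ->
    halfline_cdf (gamma_kernel (2 * m + 1) 1) (x / phi)
    < halfline_cdf (mckay_kernel m (th c)) (x / phi).
  move=> c1 x0 /(Ap x x0)[xp0 xpa].
  by apply: (gamma_lt_mckay hm totalN) => //; exact: th1.
have Z_gt (c x : R) : 1 < c -> 0 < x -> x <= A ->
    halfline_cdf (gamma_kernel (m + 1 / 2) (1 / 2)) (x / phi) <= 1 / 2 ->
    x < Med (Z c).
  move=> c1 x0 xA h; apply: lt_Med; have [cF _ _] := law_Z c c1.
  by rewrite cF// lte_fin (lt_le_trans (ZG1 c x c1 x0 xA)).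
have ubphi : (2 * m + 1) * phi * expR (- (1 / (3 * (2 * m + 1)))) = ub * phi.
  by rewrite /ub mulrAC.
have Z_ub (c : R) : 1 < c ->
    Med (Z c) < (2 * m + 1) * phi * expR (- (1 / (3 * (2 * m + 1)))).
  move=> c1; rewrite ubphi; apply: (Med_lt (law_Z c c1)); first exact: mulr_gt0.
  apply: (le_lt_trans G2ub); rewrite -{1}(mulfK phin ub); apply: ZG2 => //.
    exact: mulr_gt0.
  by rewrite /A ler_pM2r.
split; [|split; [|split; [|split]]].
- move=> c1 c2 h1 h12; have h2 := lt_trans h1 h12.
  apply: (Med_lt_of_cdf_lt (law_Z c2 h2) (law_Z c1 h1) A0 (ltW (ZA c2 h2))).
  move=> x x0 /(Ap x x0)[xp0 xpa].
  apply: (halfline_cdf_mckay_lt hm totalN) => //; first exact: th1.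
  have e (c : R) : 1 < c -> th c = 1 + (c ^+ 2 - 1)^-1.
    by move=> /cc0 h; rewrite /th; field; rewrite gt_eqF.
  have i1 := cc0 c1 h1; have i2 := cc0 c2 h2.
  have p1 : 0 <= c1 := ltW (lt_trans ltr01 h1).
  have p2 : 0 <= c2 := ltW (lt_trans ltr01 h2).
  by rewrite !e// ltrD2l ltf_pV2 ?posrE// ltrD2r ltr_sqr ?nnegrE.
- move=> d1 d2 T1 T2 P1 P2 G1 G2 /law_G1 lG1 /law_G2 lG2 c c1; split.
    apply: (Med_lt_of_cdf_lt (law_Z c c1) lG1 A0 (ltW (ZA c c1))) => x x0 xA.
    exact: ZG1.
  apply: (Med_lt_of_cdf_lt lG2 (law_Z c c1) A0) => [|x x0 xA]; first by rewrite AE.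
  exact: ZG2.
- move=> c c1; have l0 : 0 < 2 * ln 2 :> R by rewrite mulr_gt0// ln_gt0// ltr1n.
  split.
    rewrite mulrAC ltr_pM2r//.
    have n0 : - (2 * ln 2) / (2 * m + 1) != 0.
      by apply: mulf_neq0; rewrite ?oppr_eq0 ?invr_eq0 gt_eqF.
    have h := expR_gt1Dx n0; rewrite -(ltr_pM2l a0) in h.
    rewrite [ltLHS](_ : _ = (2 * m + 1) * (1 + - (2 * ln 2) / (2 * m + 1)))//.
    by field; rewrite gt_eqF.
  have e1 : expR (- (2 * ln 2) / (2 * m + 1)) <= 1.
    by rewrite -[leRHS](@expR0 R) ler_expR mulNr oppr_le0 divr_ge0// ltW.
  apply: Z_gt => //; first by rewrite !mulr_gt0 ?expR_gt0.
    by rewrite -[leRHS]mulr1 ler_pM2l.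
  rewrite halfline_cdf_le_half//.
  rewrite [_ * phi * _]mulrAC (mulfK phin).
  have := gamma_median_lb r0 half0.
  have -> : (m + 1 / 2) / (1 / 2) = 2 * m + 1 by field.
  have -> : - (ln 2 / (m + 1 / 2)) = - (2 * ln 2) / (2 * m + 1).
    by field; rewrite !gt_eqF//; lra.
  exact.
- move=> c c1; split; first exact: Z_ub.
  have u0 : 0 < 1 / (3 * (2 * m + 1)) by rewrite divr_gt0// mulr_gt0.
  rewrite mulrAC ltr_pM2r//.
  have h := expRN_lt_quadratic u0; rewrite -(ltr_pM2l a0) in h.
  rewrite [ltRHS](_ : _ = (2 * m + 1) * (1 - 1 / (3 * (2 * m + 1))
    + (1 / (3 * (2 * m + 1))) ^+ 2 / 2))//.
  by field; rewrite gt_eqF.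
- move=> m12 c c1; split.
    have x0 : 0 < (2 * m + 1 / 3) * phi by rewrite mulr_gt0//; lra.
    apply: Z_gt => //.
      by rewrite ler_pM2r//; lra.
    rewrite halfline_cdf_le_half// mulfK//.
    have r1 : 1 <= m + 1 / 2 by lra.
    have := gamma_median_lb3 r0 half0 r1.
    by have -> : (m + 1 / 2 - 1 / 3) / (1 / 2) = 2 * m + 1 / 3 by field.
  apply: (le_trans (ltW (Z_ub c c1))); rewrite mulrAC ler_pM2r//.
  have a2 : 2 <= 2 * m + 1 by lra.
  by apply: (le_trans (mul_expRN_le_ln2 a2)); rewrite addrK.
Qed.
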